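(* Let $T$ be a complete first-order theory and let $1<k<\omega$. (1) For any antichain tuple $\bar\nu=\langle \nu_0,\dots,\nu_{k-1}\rangle$ of elements of ${}^{\omega>}\omega$ of size $k$, $T$ has TP$_1$ if and only if $T$ has $\bar\nu^{str}$-TP$_1$. (2) For any antichain tuple $\bar\nu=\langle \nu_0,\dots,\nu_{k-1}\rangle$ of elements of ${}^{\omega>}2$ of size $k$, $T$ has SOP$_2$ if and only if $T$ has $\bar\nu^{str}$-SOP$_2$.
   Context: Work in a monster model of $T$. For ordinals $\lambda,\kappa$, ${}^{\lambda>}\kappa$ is the set of functions from some ordinal $<\lambda$ to $\kappa$ (sequences), ordered by $\eta\trianglelefteq\nu$ iff $\eta$ is an initial segment of $\nu$; $\eta\wedge\nu$ is the longest common initial segment; $\eta<_{lex}\nu$ iff $\eta\triangleleft\nu$, or $\eta,\nu$ are $\trianglelefteq$-incomparable and $\eta(\alpha)<\nu(\alpha)$ where $\alpha=\mathrm{dom}(\eta\wedge\nu)$. Two finite tuples $\bar\eta,\bar\xi$ of the tree are strongly similar ($\bar\eta\sim_{str}\bar\xi$) if they have the same quantifier-free type in the language $\{\trianglelefteq,\wedge,<_{lex}\}$ (with $\wedge$ a binary function). A tuple is an antichain if its entries are pairwise $\trianglelefteq$-incomparable ($\perp$). A formula $\varphi(x,y)$ has TP$_1$ if there is $\langle a_\eta:\eta\in{}^{\omega>}\omega\rangle$ such that for every $\eta\in{}^{\omega}\omega$, $\{\varphi(x,a_{\eta\lceil n}):n<\omega\}$ is consistent, and for all $\eta\perp\nu$,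 $\{\varphi(x,a_\eta),\varphi(x,a_\nu)\}$ is inconsistent. $\varphi$ has SOP$_2$ if the same holds with ${}^{\omega>}2$ and ${}^\omega 2$ in place of ${}^{\omega>}\omega$ and ${}^\omega\omega$. For a tuple $\bar\nu$ in ${}^{\omega>}\omega$, $\varphi$ has $\bar\nu^{str}$-TP$_1$ if there is $\langle a_\eta:\eta\in{}^{\omega>}\omega\rangle$ such that (a) for all $\eta\in{}^\omega\omega$, $\{\varphi(x,a_{\eta\lceil m}):m<\omega\}$ is consistent, and (b) for every tuple $\bar\mu$ in ${}^{\omega>}\omega$ with $\bar\mu\sim_{str}\bar\nu$, $\{\varphi(x,a_\mu):\mu\in\bar\mu\}$ is inconsistent. $\bar\nu^{str}$-SOP$_2$ (for $\bar\nu$ in ${}^{\omega>}2$) is defined the same way with the binary tree ${}^{\omega>}2$ and branches in ${}^\omega2$. $T$ has one of these properties if some formula has it modulo $T$. *)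

(* Defs.v *)
From mathcomp Require Import all_boot.
Set Implicit Arguments. Unset Strict Implicit. Unset Printing Implicit Defensive.

Record signature := Signature {
  func : Type; relsym : Type; farity : func -> nat; rarity : relsym -> nat }.

(* An L-structure (nonempty domain).  Symbols are interpreted on lists of
   arguments; only the values at lists of the correct arity matter for
   well-formed formulas. *)
Record structure (L : signature) := Structure {
  dom :> Type;
  dom_inh : dom;
  finterp : func L -> seq dom -> dom;
  rinterp : relsym L -> seq dom -> Prop }.

Inductive term (L : signature) : Type :=
  | Var : nat -> term L
  | App : func L -> seq (term L) -> term L.

Inductive formula (L : signature) : Type :=
  | Fal : formula L
  | Eq : term L -> term L -> formula L
  | Rel : relsym L -> seq (term L) -> formula L
  | Not : formula L -> formula L
  | And : formula L -> formula L -> formula L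
  | Or : formula L -> formula L -> formula L
  | Imp : formula L -> formula L -> formula L
  | Ex : nat -> formula L -> formula L
  | All : nat -> formula L -> formula L.

Fixpoint term_wf L (t : term L) : bool :=
  match t with
  | Var _ => true
  | App f ts => (size ts == farity f) && all (@term_wf L) ts
  end.

Fixpoint formula_wf L (p : formula L) : bool :=
  match p with
  | Fal => true
  | Eq t u => term_wf t && term_wf u
  | Rel r ts => (size ts == rarity r) && all (@term_wf L) ts
  | Not q => formula_wf q
  | And q r | Or q r | Imp q r => formula_wf q && formula_wf r
  | Ex _ q | All _ q => formula_wf q
  end.

Fixpoint term_fv L (t : term L) : seq nat :=
  match t with
  | Var i => [:: i]
  | App _ ts => flatten (map (@term_fv L) ts)
  end.

Fixpoint formula_fv L (p : formula L) : seq nat :=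
  match p with
  | Fal => [::]
  | Eq t u => term_fv t ++ term_fv u
  | Rel _ ts => flatten (map (@term_fv L) ts)
  | Not q => formula_fv q
  | And q r | Or q r | Imp q r => formula_fv q ++ formula_fv r
  | Ex x q | All x q => filter (fun y => y != x) (formula_fv q)
  end.

Definition sentence L (p : formula L) : bool := formula_fv p == [::].

Fixpoint eval L (M : structure L) (e : nat -> M) (t : term L) : M :=
  match t with
  | Var i => e i
  | App f ts => finterp f (map (eval e) ts)
  end.

Definition upd (M : Type) (e : nat -> M) (x : nat) (m : M) : nat -> M :=
  fun y => if y == x then m else e y.

Fixpoint sat L (M : structure L) (e : nat -> M) (p : formula L) : Prop :=
  match p with
  | Fal => False
  | Eq t u => eval e t = eval e u
  | Rel r ts => rinterp r (map (eval e) ts)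
  | Not q => ~ sat e q
  | And q r => sat e q /\ sat e r
  | Or q r => sat e q \/ sat e r
  | Imp q r => sat e q -> sat e r
  | Ex x q => exists m : M, sat (upd e x m) q
  | All x q => forall m : M, sat (upd e x m) q
  end.

Definition model L (M : structure L) (T : formula L -> Prop) : Prop :=
  forall s, T s -> forall e : nat -> M, sat e s.

Definition complete_theory L (T : formula L -> Prop) : Prop :=
  (forall s, T s -> formula_wf s /\ sentence s) /\
  (exists M : structure L, model M T) /\
  (forall s, formula_wf s -> sentence s ->
     (forall M : structure L, model M T -> forall e : nat -> M, sat e s) \/
     (forall M : structure L, model M T -> forall e : nat -> M, ~ sat e s)).

(* phi(x, y): the variables 0..n-1 form the tuple x, the variables >= n
   form the parameter tuple y.  [env b a n] assigns b to x and a to y. *)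
Definition env (M : Type) (b a : nat -> M) (n : nat) : nat -> M :=
  fun i => if i < n then b i else a (i - n).

Fixpoint meet (A : eqType) (s t : seq A) : seq A :=
  match s, t with
  | x :: s', y :: t' => if x == y then x :: meet s' t' else [::]
  | _, _ => [::]
  end.

Definition incomparable (A : eqType) (s t : seq A) : bool :=
  ~~ prefix s t && ~~ prefix t s.

Fixpoint lexlt (A : eqType) (ltA : rel A) (s t : seq A) : bool :=
  match s, t with
  | [::], [::] => false
  | [::], _ :: _ => true
  | _ :: _, [::] => false
  | x :: s', y :: t' => if x == y then lexlt ltA s' t' else ltA x y
  end.

(* Terms of the language {⊴, ∧, <_lex} over variables indexed by nat. *)
Inductive mterm : Type :=
  | MV : nat -> mterm
  | MMeet : mterm -> mterm -> mterm.

Fixpoint mterm_vars_lt (k : nat) (u : mterm) : bool :=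
  match u with
  | MV i => i < k
  | MMeet u v => mterm_vars_lt k u && mterm_vars_lt k v
  end.

Fixpoint meval (A : eqType) (s : seq (seq A)) (u : mterm) : seq A :=
  match u with
  | MV i => nth [::] s i
  | MMeet u v => meet (meval s u) (meval s v)
  end.

(* Strong similarity: same length and same quantifier-free type in
   {⊴, ∧, <_lex} (atomic formulas: =, ⊴, <_lex between terms). *)
Definition strongly_similar (A : eqType) (ltA : rel A) (s t : seq (seq A)) : Prop :=
  size s = size t /\
  forall u v : mterm, mterm_vars_lt (size s) u -> mterm_vars_lt (size s) v ->
    [/\ (meval s u == meval s v) = (meval t u == meval t v),
        prefix (meval s u) (meval s v) = prefix (meval t u) (meval t v) &
        lexlt ltA (meval s u) (meval s v) = lexlt ltA (meval t u) (meval t v)].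

Definition antichain (A : eqType) (s : seq (seq A)) : bool :=
  pairwise (@incomparable A) s.

(* (a): every branch {phi(x, a_{eta|m}) : m < omega} is consistent, i.e.
   (in a model M) finitely satisfiable. *)
Definition branches_consistent L (A : eqType) (M : structure L)
    (phi : formula L) (n : nat) (a : seq A -> nat -> M) : Prop :=
  forall (eta : nat -> A) (F : seq nat),
    exists b : nat -> M, forall m, m \in F -> sat (env b (a (mkseq eta m)) n) phi.

Definition tree_TP L (T : formula L -> Prop) (A : eqType) : Prop :=
  exists (phi : formula L) (n : nat) (M : structure L) (a : seq A -> nat -> M),
    [/\ formula_wf phi, model M T, @branches_consistent L A M phi n a &
        forall eta nu : seq A, incomparable eta nu ->
          ~ exists b : nat -> M,
              sat (env b (a eta) n) phi /\ sat (env b (a nu) n) phi].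

Definition tree_strTP L (T : formula L -> Prop) (A : eqType) (ltA : rel A)
    (nubar : seq (seq A)) : Prop :=
  exists (phi : formula L) (n : nat) (M : structure L) (a : seq A -> nat -> M),
    [/\ formula_wf phi, model M T, @branches_consistent L A M phi n a &
        forall mubar : seq (seq A), strongly_similar ltA mubar nubar ->
          ~ exists b : nat -> M,
              forall mu, mu \in mubar -> sat (env b (a mu) n) phi].

Definition ltb_bool : rel bool := fun x y => ~~ x && y.

Definition TP1 L (T : formula L -> Prop) : Prop := tree_TP T nat.
Definition SOP2 L (T : formula L -> Prop) : Prop := tree_TP T bool.
Definition str_TP1 L (T : formula L -> Prop) (nubar : seq (seq nat)) : Prop :=
  tree_strTP T ltn nubar.
Definition str_SOP2 L (T : formula L -> Prop) (nubar : seq (seq bool)) : Prop :=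
  tree_strTP T ltb_bool nubar.

(* Main.v *)
Require Import Defs.
From mathcomp Require Import all_boot boolp.
From mathcomp Require filter.
Set Implicit Arguments. Unset Strict Implicit. Unset Printing Implicit Defensive.

(** If T has TP_1 then two entries of an antichain are already inconsistent.
Conversely assume that no formula has TP_1 (SOP_2), and take a tree of
parameters of phi with consistent branches; we find a consistent copy of every
finite tree shape, in particular one strongly similar to the given tuple.

By a Ramsey theorem for copies of a fixed shape in K-branching trees, we may
assume that the consistency of a copy depends on its shape only.  Build the
shape from chains by replacing, inside a context F, a subtree in which at most j
siblings branch off everywhere by j+1 siblings.  Suppose this fails.  For j = 1,
chains over F are consistent and incomparable chains are not, which is SOP_2 for
a conjunction of instances of phi.  For j >= 2, sets of j siblings at a node v
give a tree of points that are consistent along antichains and inconsistent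
when comparable.  No conjunction of phi needs to have SOP_2 then, so SOP_2 is
applied to other formulas: a configuration W lying above all points of a branch
solves "W is inconsistent with this point" along the branch, so, SOP_2 failing,
some configuration of the same kind solves it at two incomparable points.
Iterating, all patterns built by the operations "jointly consistent" and
"pairwise inconsistent" occur, among them SOP_2 for finite binary trees of any
height, and an ultrapower yields an infinite one. *)

(** * Labelled trees and their Ramsey property *)

(** Whether a configuration has a prescribed pattern is expressed by a formula in its parameters,
    with quantifiers over solutions. This is why the failure of SOP_2 is assumed for all formulas of
    [T]; the parameters of W become object variables, and points are treated as blocks of variables.
    The obstacle is that a merge happens at two nodes that cannot be prescribed, and keeps nothing
    else of the tree but one top. So the invariant is that trees of every height exist whose nodes
    all carry the pattern [G]. Two operations preserve it: two consecutive nodes of a branch become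
    [Csep G G], and merges produce [Cjoin G G]. They suffice, since [forks n.+1] lies in the join of
    two copies of [Csep G G] as soon as [G] contains a point and [forks n]. All this takes place
    over the labels of the context. Their number is bounded in terms of the context alone, so one
    conjunction of bounded length serves for trees of every height. *)

Section Trees.
Variable K : nat.
Local Notation I := 'I_K.

Inductive tree (X : Type) : Type :=
  | Emp : tree X
  | Un : X -> tree X -> tree X
  | Br : (I -> tree X) -> tree X.
Arguments Emp {X}.

(* Meets are [Br] nodes, which carry no label, so [emb] preserves meets and the
   order of siblings but not levels. *)
Inductive emb (X : Type) : tree X -> tree X -> Prop :=
  | emb_E t : emb Emp t
  | emb_UnS x s t : emb s t -> emb (Un x s) (Un x t)
  | emb_Un x s t : emb s t -> emb s (Un x t)
  | emb_BrS f g : (forall i, emb (f i) (g i)) -> emb (Br f) (Br g)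
  | emb_Br i s g : emb s (g i) -> emb s (Br g).
#[local] Hint Constructors emb : core.

Fixpoint tmap X Y (h : X -> Y) (t : tree X) : tree Y :=
  match t with
  | Emp => Emp
  | Un x t => Un (h x) (tmap h t)
  | Br f => Br (fun i => tmap h (f i))
  end.

Definition shp X (t : tree X) : tree unit := tmap (fun=> tt) t.

Fixpoint fullS (n : nat) : tree unit :=
  if n is n'.+1 then Un tt (Br (fun=> fullS n')) else Emp.

Definition full X n (t : tree X) : Prop := shp t = fullS n.

Section Basics.
Variable X : Type.
Implicit Types s t u : tree X.

Lemma emb_refl t : emb t t.
Proof. by elim: t => //= [x t IH|f IH]; auto. Qed.
#[local] Hint Resolve emb_refl : core.

Lemma emb_trans t s u : emb s t -> emb t u -> emb s u.
Proof.
move=> st tu; elim: tu s st => {t u}.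
- by move=> t s st; inversion st; subst; auto.
- by move=> x t u tu IH s st; inversion st; subst; auto.
- by auto.
- move=> f g fg IH s st; inversion st; subst; eauto.
- by move=> i t g tg IH s st; apply: (emb_Br (i := i)); auto.
Qed.

Lemma emb_shp s t : emb s t -> emb (shp s) (shp t).
Proof.
elim=> //= [x s' t' _ IH|x s' t' _ IH|f g _ IH|i s' g _ IH].
- exact: emb_UnS.
- exact: emb_Un.
- exact: emb_BrS.
- exact: (emb_Br (i := i)).
Qed.

Lemma shp_E t : shp t = Emp -> t = Emp.
Proof. by case: t. Qed.

Lemma shp_Un t S : shp t = Un tt S -> exists x t', t = Un x t' /\ shp t' = S.
Proof. by case: t => //= x t' [<-]; exists x, t'. Qed.

Lemma shp_Br t g : shp t = Br g -> exists f, t = Br f /\ forall i, shp (f i) = g i.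
Proof. by case: t => //= f [<-]; exists f. Qed.

Lemma full_S n t : full n.+1 t ->
  exists x f, t = Un x (Br f) /\ forall i, full n (f i).
Proof.
by move=> /shp_Un[x [t' [-> /shp_Br[f [-> H]]]]]; exists x, f.
Qed.

Lemma fullSP n (x : X) (f : I -> tree X) : (forall i, full n (f i)) -> full n.+1 (Un x (Br f)).
Proof.
move=> H; rewrite /full /shp /=; congr (Un _ (Br _)).
by apply/funext => i; apply: H.
Qed.

Lemma emb_lift t S : emb S (shp t) -> exists s, emb s t /\ shp s = S.
Proof.
elim: t S => [|x t IH|f IH] S e; inversion e; subst; try by exists Emp.
- by have [s' [? <-]] := IH _ H1; exists (Un x s'); split; auto.
- by have [s' [? <-]] := IH _ H1; exists s'; split; auto.
- have /fin_all_exists[g gP] : forall i, exists s, emb s (f i) /\ shp s = f0 i.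
    by move=> i; apply: IH; apply: H1.
  exists (Br g); split; first by apply: emb_BrS => i; case: (gP i).
  by rewrite /shp /=; congr Br; apply/funext => i; case: (gP i).
- have [s' [? <-]] := IH _ _ H1.
  by exists s'; split=> //; apply: (emb_Br (i := i)).
Qed.

End Basics.
#[local] Hint Resolve emb_refl : core.

Hypothesis K_gt0 : 0 < K.

Lemma emb_fullS m n : m <= n -> emb (fullS m) (fullS n).
Proof.
elim: n m => [|n IH] [|m] //= mn.
by apply/emb_UnS/emb_BrS => i; apply: IH.
Qed.

Lemma full_trunc X m n (t : tree X) : m <= n -> full n t -> exists s, emb s t /\ full m s.
Proof. by move=> mn ft; apply: emb_lift; rewrite ft; apply: emb_fullS. Qed.

Lemma shape_in_full (S : tree unit) : exists n, emb S (fullS n).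
Proof.
elim: S => [|[] S [n IH]|f /fin_all_exists[h IH]].
- by exists 0; apply: emb_E.
- exists n.+1 => /=; apply: emb_UnS; apply: (emb_Br (i := Ordinal K_gt0)); exact: IH.
- exists (\max_i h i).+1 => /=; apply/emb_Un/emb_BrS => i.
  by apply: emb_trans (IH i) _; apply: emb_fullS; apply: leq_bigmax.
Qed.

Lemma full_contains X (S : tree unit) : exists n, forall t : tree X, full n t ->
  exists s, emb s t /\ shp s = S.
Proof. by have [n H] := shape_in_full S; exists n => t ft; apply: emb_lift; rewrite ft. Qed.

(** * Ramsey theorem for copies of a fixed shape *)

Section Ramsey.
Variable X : Type.
Implicit Types (s t u : tree X).

Definition homogeneous (S : tree unit) (chi : tree X -> Prop) t : Prop :=
  (forall s, emb s t -> shp s = S -> chi s) \/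
  (forall s, emb s t -> shp s = S -> ~ chi s).

(** [N] depends neither on the tree nor on the colouring, so it can be fixed before the colourings
    of an inductive step are known. *)
Definition ramsey (S : tree unit) : Prop := forall n, exists N, forall t (chi : tree X -> Prop),
  full N t -> exists t', [/\ emb t' t, full n t' & homogeneous S chi t'].

Lemma homogeneous_emb S chi t t' : emb t' t -> homogeneous S chi t -> homogeneous S chi t'.
Proof.
by move=> e [] H; [left|right] => s st; apply: H; apply: emb_trans st e.
Qed.

(** The bound depends on the shape only: it becomes the number of colourings to be homogenized,
    which must be known before the trees are given. *)
Lemma finite_subtrees (S : tree unit) : exists m, forall t, shp t = S ->
  exists l : nat -> tree X, forall s, emb s t -> exists2 k, k < m & s = l k.
Proof.
elim: S => [|[] S [m IH]|f /fin_all_exists[h IH]].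
- exists 1 => t /shp_E ->; exists (fun=> Emp) => s e; exists 0 => //.
  by inversion e.
- exists (m + m) => t /shp_Un[x [t' [-> /IH[l lP]]]].
  exists (fun k => if k < m then l k else Un x (l (k - m))) => s e.
  inversion e; subst.
  + by have [k km ->] := lP _ (emb_E _); exists k; rewrite ?km // ltn_addr.
  + have [k km ->] := lP _ H1; exists (m + k); first by rewrite ltn_add2l.
    by rewrite ltnNge leq_addr /= addKn.
  + by have [k km ->] := lP _ H1; exists k; rewrite ?km // ltn_addr.
- pose m := (\max_i h i).+1.
  pose C := (unit + (I * 'I_m) + {ffun I -> 'I_m})%type.
  exists #|{: C}| => t /shp_Br[g [-> gf]].
  have /fin_all_exists[l lP] : forall i, exists l : nat -> tree X,
      forall s, emb s (g i) -> exists2 k, k < m & s = l k.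
    move=> i; have [l lP] := IH i (g i) (gf i); exists l => s /lP[k kh ->].
    by exists k => //; rewrite ltnS; apply: leq_trans (ltnW kh) _; apply: leq_bigmax.
  pose dec (c : C) : tree X := match c with
    | inl (inl _) => Emp
    | inl (inr (i, k)) => l i k
    | inr c => Br (fun i => l i (c i)) end.
  exists (fun k => if insub k is Some o then dec (enum_val (o : 'I_#|{: C}|)) else Emp).
  have key s (c : C) : s = dec c -> exists2 k, k < #|{: C}| & s =
      if insub k is Some o then dec (enum_val (o : 'I_#|{: C}|)) else Emp.
    move=> ->; exists (enum_rank c); first exact: ltn_ord.
    by rewrite valK enum_rankK.
  move=> s e; inversion e; subst.
  + by apply: (key _ (inl (inl tt))).
  + have /fin_all_exists[c cP] : forall i, exists k : 'I_m, f0 i = l i k.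
      by move=> i; have [k km ->] := lP i _ (H1 i); exists (Ordinal km).
    apply: (key _ (inr [ffun i => c i])) => /=; congr Br.
    by apply/funext => i; rewrite ffunE.
  + have [k km ->] := lP i _ H1.
    by apply: (key _ (inl (inr (i, Ordinal km)))).
Qed.

Lemma ramsey_iter S k n : ramsey S -> exists N, forall t (chi : nat -> tree X -> Prop),
  full N t -> exists t', [/\ emb t' t, full n t' & forall j, j < k -> homogeneous S (chi j) t'].
Proof.
move=> RS; elim: k => [|k [N IH]].
  by exists n => t chi ft; exists t.
have [N' HN'] := RS N; exists N' => t chi /(HN' t (chi k))[t1 [e1 f1 h1]].
have [t' [e' f' h']] := IH t1 chi f1; exists t'; split=> //.
  exact: emb_trans e' e1.
move=> j; rewrite ltnS leq_eqVlt => /orP[/eqP->|]; last exact: h'.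
exact: homogeneous_emb h1.
Qed.

Definition updI T (f : I -> T) i z : I -> T := fun k => if k == i then z else f k.

Lemma updI_id T (f : I -> T) i z : updI f i z i = z.
Proof. by rewrite /updI eqxx. Qed.

Lemma updI_same T (f : I -> T) i : updI f i (f i) = f.
Proof. by apply/funext => k; rewrite /updI; case: eqP => // ->. Qed.

Lemma updI_twice T (f : I -> T) i y z : updI (updI f i y) i z = updI f i z.
Proof. by apply/funext => k; rewrite /updI; case: eqP. Qed.

Definition copies (Ss : I -> tree unit) (g s : I -> tree X) : Prop :=
  forall i, emb (s i) (g i) /\ shp (s i) = Ss i.

(** Coordinates are treated one at a time. After truncation there are finitely many tuples in the
    other coordinates, and each of them colours the copies in coordinate [j]; once all these
    colourings are homogeneous, the colour no longer depends on that coordinate. *)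
Lemma ramsey_product_seq (Ss : I -> tree unit) (J : seq I) n :
  (forall i, ramsey (Ss i)) ->
  exists N, forall (g : I -> tree X) (chi : (I -> tree X) -> Prop),
    (forall i, full N (g i)) ->
    exists g', [/\ forall i, emb (g' i) (g i), forall i, full n (g' i) &
      forall s s' : I -> tree X, copies Ss g' s -> copies Ss g' s' ->
        (forall i, i \notin J -> s i = s' i) -> chi s -> chi s'].
Proof.
move=> RS; elim: J => [|j J [N1 IH]].
  exists n => g chi fg; exists g; split=> // s s' _ _ ss'.
  by have -> : s = s' by apply/funext => i; apply: ss'.
have [m mP] := finite_subtrees (Br (fun=> fullS N1)).
have [N3 N3P] := ramsey_iter m N1 (RS j).
exists (maxn N1 N3) => g chi fg.
have /fin_all_exists[g1 g1P] : forall i, exists s, emb s (g i) /\ full N1 s.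
  by move=> i; apply: full_trunc (fg i); apply: leq_maxl.
have [tj [etj ftj]] : exists s, emb s (g j) /\ full N3 s.
  by apply: full_trunc (fg j); apply: leq_maxr.
have [l lP] : exists l : nat -> tree X, forall s, emb s (Br g1) ->
    exists2 k, k < m & s = l k.
  apply: mP; rewrite /shp /=; congr Br; apply/funext => i.
  by case: (g1P i).
(* Tuples are listed as subtrees of [Br g1]; their entry at [j] is overwritten by [u]. *)
pose chs k u := if l k is Br s then chi (updI s j u) else True.
have [uj [euj fuj huj]] := N3P tj chs ftj.
pose g2 := updI g1 j uj.
have fg2 i : full N1 (g2 i).
  by rewrite /g2 /updI; case: eqP => // _; case: (g1P i).
have [g' [eg' fg' hg']] := IH g2 chi fg2.
exists g'; split=> //.
  move=> i; apply: emb_trans (eg' i) _; rewrite /g2 /updI.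
  case: eqP => [->|_]; last by case: (g1P i).
  exact: emb_trans euj etj.
have keyj (s : I -> tree X) z z' : copies Ss g' (updI s j z) -> copies Ss g' (updI s j z') ->
    chi (updI s j z) -> chi (updI s j z').
  move=> c c'.
  have [k km lk] : exists2 k, k < m & Br (updI s j Emp) = l k.
    apply: lP; apply: emb_BrS => i; have [] := c i.
    rewrite /updI; case: (i =P j) => [_ _ _|ij e _]; first exact: emb_E.
    apply: emb_trans e _; apply: emb_trans (eg' i) _.
    by rewrite /g2 /updI; move/eqP/negPf: ij => ->.
  have [ej sj] := c j; have [ej' sj'] := c' j.
  move: (eg' j) ej sj ej' sj'; rewrite /g2 !updI_id => ej2 ej sj ej' sj'.
  case: (huj k km) => H.
    move=> _; move: (H z' (emb_trans ej' ej2) sj').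
    by rewrite /chs -lk updI_twice.
  move: (H z (emb_trans ej ej2) sj).
  by rewrite /chs -lk updI_twice.
move=> s s' cs cs' ss' chis.
pose s2 := updI s' j (s j).
have cs2 : copies Ss g' s2.
  by move=> i; rewrite /s2 /updI; case: eqP => [->|_].
have chi2 : chi s2.
  apply: hg' cs cs2 _ chis => i iJ; rewrite /s2 /updI; case: (i =P j) => [->//|ij].
  by apply: ss'; rewrite inE negb_or iJ andbT; apply/eqP.
rewrite -(updI_same s' j); apply: keyj chi2 => //.
by rewrite updI_same.
Qed.

Lemma ramsey_product (Ss : I -> tree unit) n : (forall i, ramsey (Ss i)) ->
  exists N, forall (g : I -> tree X) (chi : (I -> tree X) -> Prop),
    (forall i, full N (g i)) ->
    exists g', [/\ forall i, emb (g' i) (g i), forall i, full n (g' i) &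
      (forall s : I -> tree X, copies Ss g' s -> chi s) \/ (forall s : I -> tree X, copies Ss g' s -> ~ chi s)].
Proof.
move=> RS; have [N H] := ramsey_product_seq (enum I) n RS; exists N => g chi fg.
have [g' [eg fg' hg]] := H g chi fg; exists g'; split=> //.
have [[s [cs chis]]|no] := EM (exists s : I -> tree X, copies Ss g' s /\ chi s).
  left=> s' cs'; apply: hg cs cs' _ chis => i; by rewrite mem_enum.
by right=> s cs chis; apply: no; exists s.
Qed.

Fixpoint hered (G : X -> (I -> tree X) -> Prop) (t : tree X) : Prop :=
  match t with
  | Un x (Br f) => G x f /\ forall i, hered G (f i)
  | _ => True
  end.

(** Children are thinned out again after their parent has been treated, so a property of nodes must
    survive passing to subtrees. *)
Definition antitone (G : X -> (I -> tree X) -> Prop) : Prop :=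
  forall x f g, (forall i, emb (g i) (f i)) -> G x f -> G x g.

(** Induction on the sum of the heights. If the root has [A], then either some child already
    contains the full tree for [B], or every child contains one for [A] of height one less, and the
    root completes them. *)
Lemma pigeonhole (A B : X -> (I -> tree X) -> Prop) m n t :
  antitone A -> antitone B -> hered (fun x f => A x f \/ B x f) t -> full (m + n) t ->
  (exists t', [/\ emb t' t, full m t' & hered A t']) \/
  (exists t', [/\ emb t' t, full n t' & hered B t']).
Proof.
move=> aA aB; move: {2}(m + n) (erefl (m + n)) => k.
elim: k m n t => [|k IH] [|m] [|n] t // kE ht ft;
  try by [left; exists Emp; split => //; exact: emb_E
         |right; exists Emp; split => //; exact: emb_E].
move: ft; rewrite kE => /full_S[x [f [tE ff]]]; subst t.
case: ht => [] [Ax|Bx] hf.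
- have H i : (exists t', [/\ emb t' (f i), full m t' & hered A t']) \/
      (exists t', [/\ emb t' (f i), full n.+1 t' & hered B t']).
    have km : m + n.+1 = k by case: kE.
    by apply: (IH _ _ _ km); [exact: hf|rewrite km].
  have [[i [t' [e f' h']]]|no] := EM (exists i t', [/\ emb t' (f i), full n.+1 t' & hered B t']).
    right; exists t'; split=> //; apply/emb_Un; exact: emb_Br e.
  have /fin_all_exists[f' f'P] : forall i, exists t', [/\ emb t' (f i), full m t' & hered A t'].
    by move=> i; case: (H i) => // -[t' t'P]; case: no; exists i, t'.
  left; exists (Un x (Br f')); split.
  + by apply/emb_UnS/emb_BrS => i; case: (f'P i).
  + by apply: fullSP => i; case: (f'P i).
  + split; last by move=> i; case: (f'P i).
    by apply: aA Ax => i; case: (f'P i).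
- have H i : (exists t', [/\ emb t' (f i), full m.+1 t' & hered A t']) \/
      (exists t', [/\ emb t' (f i), full n t' & hered B t']).
    have km : m.+1 + n = k by move: kE; rewrite addnS => -[].
    by apply: (IH _ _ _ km); [exact: hf|rewrite km].
  have [[i [t' [e f' h']]]|no] := EM (exists i t', [/\ emb t' (f i), full m.+1 t' & hered A t']).
    left; exists t'; split=> //; apply/emb_Un; exact: emb_Br e.
  have /fin_all_exists[f' f'P] : forall i, exists t', [/\ emb t' (f i), full n t' & hered B t'].
    by move=> i; case: (H i) => // -[t' t'P]; case: no; exists i, t'.
  right; exists (Un x (Br f')); split.
  + by apply/emb_UnS/emb_BrS => i; case: (f'P i).
  + by apply: fullSP => i; case: (f'P i).
  + split; last by move=> i; case: (f'P i).
    by apply: aB Bx => i; case: (f'P i).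
Qed.

Definition local_step (G : X -> (I -> tree X) -> Prop) n N : Prop :=
  forall x g, (forall i, full N (g i)) ->
    exists g', [/\ emb (Br g') (Br g), forall i, full n (g' i) & G x g'].

(* [T] is the type of colourings: [N] must not depend on them. *)
Lemma fusion (T : Type) (G : T -> X -> (I -> tree X) -> Prop) :
  (forall c, antitone (G c)) -> (forall n, exists N, forall c, local_step (G c) n N) ->
  forall n, exists N, forall c t, full N t ->
    exists t', [/\ emb t' t, full n t' & hered (G c) t'].
Proof.
move=> aG step; elim=> [|n [N IH]].
  exists 0 => c t /shp_E ->; exists Emp; split=> //; exact: emb_E.
have [N' HN'] := step N; exists N'.+1 => c t /full_S[x [f [-> ff]]].
have [g [eg fg Gg]] := HN' c x f ff.
have /fin_all_exists[h hP] : forall i, exists t', [/\ emb t' (g i), full n t' & hered (G c) t'].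
  by move=> i; apply: IH.
exists (Un x (Br h)); split.
- apply: emb_UnS; apply: emb_trans eg; apply: emb_BrS => i; by case: (hP i).
- by apply: fullSP => i; case: (hP i).
- split; last by move=> i; case: (hP i).
  by apply: aG Gg => i; case: (hP i).
Qed.

Lemma fusion2 (T : Type) (A B : T -> X -> (I -> tree X) -> Prop) :
  (forall c, antitone (A c)) -> (forall c, antitone (B c)) ->
  (forall n, exists N, forall c, local_step (fun x f => A c x f \/ B c x f) n N) ->
  forall n, exists N, forall c t, full N t ->
    exists t', [/\ emb t' t, full n t' & hered (A c) t' \/ hered (B c) t'].
Proof.
move=> aA aB step n.
have aAB c : antitone (fun x f => A c x f \/ B c x f).
  by move=> x f g fg [H|H]; [left; apply: aA H|right; apply: aB H].
have [N HN] := fusion aAB step (n + n); exists N => c t /(HN c)[t1 [e1 f1 h1]].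
case: (pigeonhole (aA c) (aB c) h1 f1) => -[t' [e' f' h']]; exists t'.
  by split=> //; [apply: emb_trans e' e1|left].
by split=> //; [apply: emb_trans e' e1|right].
Qed.

(** The lowest label of a copy sits at some node [x] of [t], and the rest of the copy lies in the
    branching directly above [x]. *)
Lemma hered_Un (P : tree X -> Prop) S n t : full n t ->
  hered (fun x f => forall s, emb s (Br f) -> shp s = S -> P (Un x s)) t ->
  forall s, emb s t -> shp s = Un tt S -> P s.
Proof.
elim: n t => [|n IH] t; first by move=> /shp_E -> _ s e; inversion e.
move=> /full_S[x [f [-> ff]]] [H hf] s e.
case/shp_Un=> y [s' [sE ss']]; subst s; inversion e; subst; first exact: H.
inversion H2; subst; apply: (IH _ (ff i)) => //.
exact: hf.
Qed.

Lemma hered_Br (P : tree X -> Prop) Ss n t : full n t ->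
  hered (fun x f => forall s : I -> tree X, copies Ss f s -> P (Br s)) t ->
  forall s, emb s t -> shp s = Br Ss -> P s.
Proof.
elim: n t => [|n IH] t; first by move=> /shp_E -> _ s e; inversion e.
move=> /full_S[x [f [-> ff]]] [H hf] s e.
move=> sE; case/shp_Br: (sE) => s' [sE' ss']; subst s; inversion e; subst.
inversion H2; subst; first by apply: H => i.
by apply: (IH _ (ff i)) => //; apply: hf.
Qed.

(** Copies are grouped by the node at which they start. The induction hypothesis makes each group
    homogeneous, with a colour that may vary with the node, and [fusion2] then keeps nodes of one
    colour. *)
Theorem ramsey_all S : ramsey S.
Proof.
elim: S => [|[] S IH|Ss IH].
- move=> n; exists n => t chi ft; exists t; split=> //.
  have [H|H] := EM (chi Emp); [left|right] => s _ /shp_E -> //.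
- move=> n.
  pose A (chi : tree X -> Prop) x f := forall s, emb s (Br f) -> shp s = S -> chi (Un x s).
  pose B (chi : tree X -> Prop) x f := forall s, emb s (Br f) -> shp s = S -> ~ chi (Un x s).
  have [] := @fusion2 _ A B _ _ _ n.
  + by move=> c x f g fg H s e; apply: H; apply: emb_trans e _; apply: emb_BrS.
  + by move=> c x f g fg H s e; apply: H; apply: emb_trans e _; apply: emb_BrS.
  + move=> m; have [N HN] := IH m.+1; exists N => chi x g fg.
    (* Placing both children inside one cone of the root makes the colour
       independent of the direction in which a copy leaves the root. *)
    pose i0 := Ordinal K_gt0.
    have [t' [e' /full_S[y [f [tE ff]]] h']] := HN (g i0) (fun s => chi (Un x s)) (fg i0).
    have ef : emb (Br f) t' by rewrite tE; apply: emb_Un.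
    exists f; split=> //; first by apply: (emb_Br (i := i0)); apply: emb_trans e'.
    by case: h' => H; [left|right] => s es; apply: H; apply: emb_trans ef.
  move=> N HN; exists N => t chi /(HN chi)[t' [e' f' h']]; exists t'; split=> //.
  case: h' => H; [left|right].
  + exact: (hered_Un f' H).
  + exact: (@hered_Un (fun s => ~ chi s) _ _ _ f' H).
- move=> n.
  pose A (chi : tree X -> Prop) (x : X) f := forall s : I -> tree X, copies Ss f s -> chi (Br s).
  pose B (chi : tree X -> Prop) (x : X) f := forall s : I -> tree X, copies Ss f s -> ~ chi (Br s).
  have [] := @fusion2 _ A B _ _ _ n.
  + move=> c x f g fg H s cs; apply: H => i; case: (cs i) => e sh; split=> //.
    exact: emb_trans e _.
  + move=> c x f g fg H s cs; apply: H => i; case: (cs i) => e sh; split=> //.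
    exact: emb_trans e _.
  + move=> m; have [N HN] := ramsey_product m IH; exists N => chi x g fg.
    have [g' [eg fg' h]] := HN g (fun s : I -> tree X => chi (Br s)) fg.
    by exists g'; split=> //; apply: emb_BrS.
  move=> N HN; exists N => t chi /(HN chi)[t' [e' f' h']]; exists t'; split=> //.
  case: h' => H; [left|right].
  + exact: (hered_Br f' H).
  + exact: (@hered_Br (fun s => ~ chi s) _ _ _ f' H).
Qed.

End Ramsey.
End Trees.

(** * Patterns of consistency and inconsistency *)

(* A prescription for the points at the leaves: picking one side at every [Csep]
   leaves a consistent set, while points on two sides of an [Csep] are inconsistent. *)
Inductive cotree (P : Type) : Type :=
  | Cemp : cotree P
  | Cpt : P -> cotree P
  | Cjoin : cotree P -> cotree P -> cotree P
  | Csep : cotree P -> cotree P -> cotree P.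
Arguments Cemp {P}.

Fixpoint cmap P Q (h : P -> Q) (c : cotree P) : cotree Q :=
  match c with
  | Cemp => Cemp
  | Cpt p => Cpt (h p)
  | Cjoin a b => Cjoin (cmap h a) (cmap h b)
  | Csep a b => Csep (cmap h a) (cmap h b)
  end.

Definition cshp P (c : cotree P) : cotree unit := cmap (fun=> tt) c.

Fixpoint leaves P (c : cotree P) : seq P :=
  match c with
  | Cemp => [::]
  | Cpt p => [:: p]
  | Cjoin a b | Csep a b => leaves a ++ leaves b
  end.

Fixpoint cliques P (c : cotree P) : seq (seq P) :=
  match c with
  | Cemp => [:: [::]]
  | Cpt p => [:: [:: p]]
  | Cjoin a b => [seq s ++ t | s <- cliques a, t <- cliques b]
  | Csep a b => cliques a ++ cliques b
  end.

(** Joins may be swapped, so a transformation of the left side of a join, which is where [plug] has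
    its hole, also reaches the right side. *)
Inductive sub (P : Type) : cotree P -> cotree P -> Prop :=
  | sub_O c : sub Cemp c
  | sub_V p : sub (Cpt p) (Cpt p)
  | sub_J a b c d : sub a c -> sub b d -> sub (Cjoin a b) (Cjoin c d)
  | sub_Jsw a b c d : sub a d -> sub b c -> sub (Cjoin a b) (Cjoin c d)
  | sub_X a b c d : sub a c -> sub b d -> sub (Csep a b) (Csep c d)
  | sub_Jl a c d : sub a c -> sub a (Cjoin c d)
  | sub_Jr a c d : sub a d -> sub a (Cjoin c d)
  | sub_Xl a c d : sub a c -> sub a (Csep c d)
  | sub_Xr a c d : sub a d -> sub a (Csep c d).
#[local] Hint Constructors sub : core.

(* The pattern of SOP_2 on the binary tree of height [n]. *)
Fixpoint forks (n : nat) : cotree unit :=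
  if n is m.+1 then Cjoin (Cpt tt) (Csep (forks m) (forks m)) else Cemp.

(* A binary tree of height [n] of copies of [G], with [Top] at the ends of the
   branches, in which comparable nodes are inconsistent and incomparable ones
   consistent: the opposite of [forks]. *)
Fixpoint comb (G Top : cotree unit) (n : nat) : cotree unit :=
  if n is m.+1 then Csep (Cjoin (comb G Top m) (comb G Top m)) G else Top.

Definition ctx P : Type := seq (bool * cotree P).

Definition plug P (Gam : ctx P) (c : cotree P) : cotree P :=
  foldl (fun h f => if f.1 then Csep h f.2 else Cjoin h f.2) c Gam.

Definition ctx_shp P (Gam : ctx P) : ctx unit := [seq (f.1, cshp f.2) | f <- Gam].

Section Patterns.
Variables (P : Type).
Implicit Types (a b c : cotree P) (Gam : ctx P).

Lemma sub_refl c : sub c c.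
Proof. by elim: c; auto. Qed.
#[local] Hint Resolve sub_refl : core.

Lemma sub_plug Gam a b : sub a b -> sub (plug Gam a) (plug Gam b).
Proof.
elim: Gam a b => //= -[[] f] Gam IH a b ab; apply: IH; auto.
Qed.

Lemma plug_cshp Gam a : cshp (plug Gam a) = plug (ctx_shp Gam) (cshp a).
Proof. by elim: Gam a => //= -[[] f] Gam IH a; rewrite IH. Qed.

Lemma plug_inv (C : ctx unit) S c : cshp c = plug C S ->
  exists Gam a, [/\ c = plug Gam a, ctx_shp Gam = C & cshp a = S].
Proof.
elim: C S => [|[i D] C IH] S /=; first by exists [::], c.
case: i => /= /IH[Gam [a [-> <-]]]; case: a => //= a1 a2 [<- <-].
  by exists ((true, a2) :: Gam), a1.
by exists ((false, a2) :: Gam), a1.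
Qed.

Lemma leaves_plug Gam a :
  leaves (plug Gam a) = leaves a ++ flatten [seq leaves f.2 | f <- Gam].
Proof.
elim: Gam a => [|[i f] Gam IH] a /=; first by rewrite cats0.
by rewrite IH; case: i => /=; rewrite catA.
Qed.

Lemma size_leaves a : size (leaves a) = size (leaves (cshp a)).
Proof. by elim: a => //= a IHa b IHb; rewrite !size_cat IHa IHb. Qed.

Lemma sub_lift c S : sub S (cshp c) -> exists2 a, sub a c & cshp a = S.
Proof.
elim: c S => [|p|c IHc d IHd|c IHc d IHd] S e; inversion e; subst;
  try by exists Cemp.
- by exists (Cpt p).
- have [a1 ? <-] := IHc _ H2; have [a2 ? <-] := IHd _ H3.
  by exists (Cjoin a1 a2); auto.
- have [a1 ? <-] := IHd _ H2; have [a2 ? <-] := IHc _ H3.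
  by exists (Cjoin a1 a2); auto.
- by have [a1 ? <-] := IHc _ H1; exists a1; auto.
- by have [a1 ? <-] := IHd _ H1; exists a1; auto.
- have [a1 ? <-] := IHc _ H2; have [a2 ? <-] := IHd _ H3.
  by exists (Csep a1 a2); auto.
- by have [a1 ? <-] := IHc _ H1; exists a1; auto.
- by have [a1 ? <-] := IHd _ H1; exists a1; auto.
Qed.

End Patterns.
#[local] Hint Resolve sub_refl : core.

(** * Realizing patterns by the points of a relation *)

Section Valid.
Variables (P : eqType) (R : P -> P -> Prop).
Implicit Types (a b c : cotree P) (Gam : ctx P).

Definition con (s : seq P) : Prop := exists x, forall p, p \in s -> R x p.

Lemma con_sub s t : {subset s <= t} -> con t -> con s.
Proof. by move=> st [x H]; exists x => p /st; apply: H. Qed.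

Definition cross a b : Prop :=
  forall p q, p \in leaves a -> q \in leaves b -> ~ con [:: p; q].

Fixpoint separated c : Prop :=
  match c with
  | Cjoin a b => separated a /\ separated b
  | Csep a b => [/\ separated a, separated b & cross a b]
  | _ => True
  end.

Definition valid c : Prop :=
  (forall s, s \in cliques c -> con s) /\ separated c.

Lemma sub_leaves a b : sub a b -> {subset leaves a <= leaves b}.
Proof.
elim=> {a b} /= [c|p|a b c d _ IH1 _ IH2|a b c d _ IH1 _ IH2|a b c d _ IH1 _ IH2
  |a c d _ IH|a c d _ IH|a c d _ IH|a c d _ IH] x;
  rewrite ?mem_cat //; try (by case/orP=> [/IH1->|/IH2->]; rewrite ?orbT);
  by move/IH->; rewrite ?orbT.
Qed.

Lemma cliques_neq0 a : exists s, s \in cliques a.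
Proof.
elim: a => [|p|a [s IHs] b [t IHt]|a [s IHs] b _] /=.
- by exists [::].
- by exists [:: p]; rewrite inE.
- by exists (s ++ t); apply: allpairs_f.
- by exists s; rewrite mem_cat IHs.
Qed.

Lemma sub_cliques a b : sub a b ->
  forall s, s \in cliques a -> exists2 t, t \in cliques b & {subset s <= t}.
Proof.
elim=> //= {a b}.
- move=> c s; rewrite inE => /eqP->; have [t tc] := cliques_neq0 c.
  by exists t.
- by move=> p s ps; exists s.
- move=> a b c d _ IH1 _ IH2 s /allpairsP[[s1 s2] /= [/IH1[t1 h1 k1] /IH2[t2 h2 k2] ->]].
  exists (t1 ++ t2); first exact: allpairs_f.
  by move=> x; rewrite !mem_cat => /orP[/k1->|/k2->]; rewrite ?orbT.
- move=> a b c d _ IH1 _ IH2 s /allpairsP[[s1 s2] /= [/IH1[t1 h1 k1] /IH2[t2 h2 k2] ->]].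
  exists (t2 ++ t1); first exact: allpairs_f.
  by move=> x; rewrite !mem_cat => /orP[/k1->|/k2->]; rewrite ?orbT.
- move=> a b c d _ IH1 _ IH2 s; rewrite mem_cat => /orP[/IH1|/IH2] [t tc st];
    by exists t; rewrite // mem_cat tc ?orbT.
- move=> a c d _ IH s /IH[t tc st]; have [t' t'd] := cliques_neq0 d.
  exists (t ++ t'); first exact: allpairs_f.
  by move=> x /st; rewrite mem_cat => ->.
- move=> a c d _ IH s /IH[t tc st]; have [t' t'd] := cliques_neq0 c.
  exists (t' ++ t); first exact: allpairs_f.
  by move=> x /st; rewrite mem_cat orbC => ->.
- by move=> a c d _ IH s /IH[t tc st]; exists t; rewrite // mem_cat tc.
- by move=> a c d _ IH s /IH[t tc st]; exists t; rewrite // mem_cat tc orbT.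
Qed.

Lemma cross_sub a b c d : sub a c -> sub b d -> cross c d -> cross a b.
Proof.
by move=> /sub_leaves ac /sub_leaves bd H p q /ac pc /bd; apply: H.
Qed.

Lemma sub_separated a b : sub a b -> separated b -> separated a.
Proof.
elim=> //= {a b}; try by move=> a c d _ IH []; auto.
- by move=> a b c d _ IH1 _ IH2 []; auto.
- by move=> a b c d _ IH1 _ IH2 []; auto.
- move=> a b c d ac IH1 bd IH2 [sc sd cr]; split; auto.
  exact: cross_sub cr.
Qed.

Lemma sub_valid a b : sub a b -> valid b -> valid a.
Proof.
move=> ab [cb sb]; split; last exact: sub_separated sb.
by move=> s /(sub_cliques ab)[t /cb cotree st]; apply: con_sub cotree.
Qed.

Lemma cliques_plug_X Gam a b s : s \in cliques (plug Gam (Csep a b)) ->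
  s \in cliques (plug Gam a) \/ s \in cliques (plug Gam b).
Proof.
(* [plug] works outwards, and under the first frame the hole is no longer a [Csep]; the inclusion of
   cliques is what survives every frame. *)
suff H : forall a b c, {subset cliques c <= cliques a ++ cliques b} ->
    forall s, s \in cliques (plug Gam c) ->
    s \in cliques (plug Gam a) \/ s \in cliques (plug Gam b) by apply: H.
elim: Gam => [|[i f] Gam IH] a' b' c sc s' /=.
  by move/sc; rewrite mem_cat => /orP.
apply: IH; case: i => /= t.
  rewrite !mem_cat => /orP[/sc|->]; last by rewrite orbT.
  by rewrite mem_cat => /orP[]->; rewrite ?orbT.
move=> /allpairsP[[t1 t2] /= [/sc + h2 ->]]; rewrite !mem_cat.
by move=> /orP[] h1; apply/orP; [left|right]; apply: allpairs_f.
Qed.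

Lemma separated_plug_X Gam a b : separated (plug Gam a) -> separated (plug Gam b) ->
  cross a b -> separated (plug Gam (Csep a b)).
Proof.
move=> sa sb crab.
suff H : forall a b c, {subset leaves c <= leaves a ++ leaves b} ->
    (separated a -> separated b -> separated c) ->
    separated (plug Gam a) -> separated (plug Gam b) -> separated (plug Gam c).
  by apply: (H a b).
elim: Gam {sa sb} => [|[i f] Gam IH] a' b' c lc sc //=.
apply: IH; case: i => //=.
- by move=> x; rewrite !mem_cat => /orP[/lc|->]; rewrite ?orbT // mem_cat => /orP[]->; rewrite ?orbT.
- by move=> x; rewrite !mem_cat => /orP[/lc|->]; rewrite ?orbT // mem_cat => /orP[]->; rewrite ?orbT.
- move=> [sa' sf ca] [sb' _ cb]; split=> //; first exact: sc.
  by move=> p q /lc; rewrite mem_cat => /orP[pa|pb] qf; [apply: ca|apply: cb].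
- by move=> [sa' sf] [sb' _]; split=> //; apply: sc.
Qed.

Definition realizable (S : cotree unit) : Prop := exists2 c, cshp c = S & valid c.

Lemma realizable_sub S S' : sub S S' -> realizable S' -> realizable S.
Proof.
move=> ss [c cS vc]; subst S'; have [a ac aS] := sub_lift ss.
by exists a => //; apply: sub_valid vc.
Qed.

(** With indices at the leaves, validity of a pattern becomes a relation on assignments [nat -> P],
    to which definability applies. *)
Fixpoint number (S : cotree unit) (n : nat) : cotree nat :=
  match S with
  | Cemp => Cemp
  | Cpt _ => Cpt n
  | Cjoin a b => Cjoin (number a n) (number b (n + size (leaves a)))
  | Csep a b => Csep (number a n) (number b (n + size (leaves a)))
  end.

Lemma cmap_number c (E : nat -> P) n :
  (forall p i, i < size (leaves c) -> E (n + i) = nth p (leaves c) i) ->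
  cmap E (number (cshp c) n) = c.
Proof.
elim: c n => [|p|a IHa b IHb|a IHa b IHb] n //= H.
- by rewrite -[n]addn0 (H p 0).
- rewrite IHa ?IHb // => [p i ib|p i ia].
  + rewrite -size_leaves -addnA (H p) ?size_cat ?ltn_add2l //.
    by rewrite nth_cat ltnNge leq_addr /= addKn.
  + by rewrite (H p) ?size_cat ?ltn_addr // nth_cat ia.
- rewrite IHa ?IHb // => [p i ib|p i ia].
  + rewrite -size_leaves -addnA (H p) ?size_cat ?ltn_add2l //.
    by rewrite nth_cat ltnNge leq_addr /= addKn.
  + by rewrite (H p) ?size_cat ?ltn_addr // nth_cat ia.
Qed.

Lemma leaves_cmap Q (E : Q -> P) (c : cotree Q) : leaves (cmap E c) = map E (leaves c).
Proof. by elim: c => //= a -> b ->; rewrite map_cat. Qed.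

Lemma cliques_cmap Q (E : Q -> P) (c : cotree Q) : cliques (cmap E c) = map (map E) (cliques c).
Proof.
elim: c => //= a -> b ->; last by rewrite map_cat.
rewrite map_allpairs allpairs_mapl allpairs_mapr.
by apply: eq_allpairs => // s t; rewrite map_cat.
Qed.

Lemma cshp_number S n : cshp (number S n) = S.
Proof.
elim: S n => [|[]|a IHa b IHb|a IHa b IHb] n //.
- by congr Cjoin; [apply: IHa|apply: IHb].
- by congr Csep; [apply: IHa|apply: IHb].
Qed.

Lemma cshp_cmap Q Q' (E : Q -> Q') (c : cotree Q) : cshp (cmap E c) = cshp c.
Proof.
elim: c => // a IHa b IHb; [by congr Cjoin; [apply: IHa|apply: IHb]|].
by congr Csep; [apply: IHa|apply: IHb].
Qed.

(** Addresses by binary strings turn a comb into input for [fork_free]. The third clause gives each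
    branch its common solution; the last one keeps the two nodes found there consistent. *)
Lemma comb_nodes (G Top : cotree unit) n c : cshp c = comb G Top n ->
  exists (g t : seq bool -> cotree P),
  [/\ forall s, size s < n -> cshp (g s) = G /\ sub (g s) c,
      forall s, size s = n -> cshp (t s) = Top,
      forall s m, size s = n -> m < n -> sub (Csep (t s) (g (take m s))) c,
      forall s, size s = n -> sub (t s) c &
      forall s s', size s < n -> size s' < n -> incomparable s s' ->
        sub (Cjoin (g s) (g s')) c].
Proof.
elim: n c => [|n IH] c /=.
  by move=> cT; exists (fun=> Cemp), (fun=> c); split.
case: c => // c1 g /= [c1S gG]; case: c1 c1S => // c0 c1 /= [c0S c1S].
have [g0 [t0 [G0 T0 X0 S0 J0]]] := IH _ c0S.
have [g1 [t1 [G1 T1 X1 S1 J1]]] := IH _ c1S.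
exists (fun s => match s with [::] => g | b :: s => if b then g1 s else g0 s end).
exists (fun s => if s is b :: s then if b then t1 s else t0 s else Cemp).
split.
- move=> [|[] s] /=; first by auto.
  + by rewrite ltnS => /G1[]; auto.
  + by rewrite ltnS => /G0[]; auto.
- by move=> [|[] s] //= [] /eqP; [move/eqP/T1|move/eqP/T0].
- move=> [|b s] // [|m] [sn] mn /=.
    by case: b; apply: sub_X => //; auto.
  by case: b; [have := X1 s m sn mn|have := X0 s m sn mn]; auto.
- by move=> [|[] s] //= [] sn; [have := S1 s sn|have := S0 s sn]; auto.
- move=> [|b s] [|b' s'] //; rewrite /= !ltnS => sn s'n.
  case: b b' => [] [] => // inc.
  + by have := J1 s s' sn s'n inc; auto.
  + by apply/sub_Xl/sub_Jsw; [case: (G1 s sn)|case: (G0 s' s'n)].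
  + by apply/sub_Xl/sub_J; [case: (G0 s sn)|case: (G1 s' s'n)].
  + by have := J0 s s' sn s'n inc; auto.
Qed.


Lemma leaves_number S n : leaves (number S n) = iota n (size (leaves S)).
Proof. by elim: S n => //= a IHa b IHb n; rewrite IHa IHb size_cat iotaD. Qed.

Lemma sub_in_plug Gam a : sub a (plug Gam a).
Proof.
suff H : forall b, sub a b -> sub a (plug Gam b) by apply: H.
by elim: Gam => //= -[[] f] Gam IH b ab; apply: IH; auto.
Qed.

Lemma valid_plug_ext Gam a b : cliques a = cliques b -> leaves a = leaves b ->
  (separated a -> separated b) -> valid (plug Gam a) -> valid (plug Gam b).
Proof.
elim: Gam a b => [|[i f] Gam IH] a b ab lab sab /=.
  by case=> H1 H2; split; [rewrite -ab|apply: sab].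
apply: IH; case: i => /=; rewrite ?ab ?lab //.
- by case=> sa sf cr; split=> //; [apply: sab|rewrite /cross -lab].
- by case=> sa sf; split=> //; apply: sab.
Qed.

Lemma realizable_assoc C S1 S2 S3 :
  realizable (plug C (Csep (Csep S1 S2) S3)) -> realizable (plug C (Csep S1 (Csep S2 S3))).
Proof.
move=> [c /plug_inv[Gam [h [-> <- hS]]]].
case: h hS => // -[] //= a1 a2 a3 [<- <- <-] v.
exists (plug Gam (Csep a1 (Csep a2 a3))); first by rewrite plug_cshp.
apply: valid_plug_ext v => /=; rewrite ?catA //.
case=> -[s1 s2 c12] s3 c3; split=> //.
- by split=> // p q pa qa; apply: c3; rewrite // mem_cat pa orbT.
- move=> p q pa; rewrite mem_cat => /orP[qa|qa]; first exact: c12.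
  by apply: c3; rewrite // mem_cat pa.
Qed.

(** First-order definability over [R]. In [def_at] the indices differ because points become disjoint
    blocks of variables, and the renaming of the formula for [R] into two blocks has to be
    injective. *)
Inductive definable : ((nat -> P) -> Prop) -> Prop :=
  | def_true : definable (fun=> True)
  | def_at i j : i != j -> definable (fun E => R (E i) (E j))
  | def_and Q Q' : definable Q -> definable Q' -> definable (fun E => Q E /\ Q' E)
  | def_not Q : definable Q -> definable (fun E => ~ Q E)
  | def_ex i Q : definable Q -> definable (fun E => exists x, Q (upd E i x))
  | def_ext Q Q' : (forall E, Q E <-> Q' E) -> definable Q -> definable Q'.

Lemma def_all (T : eqType) (l : seq T) (F : T -> (nat -> P) -> Prop) :
  (forall t, definable (F t)) -> definable (fun E => forall t, t \in l -> F t E).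
Proof.
move=> dF; elim: l => [|t l IH].
  by apply: def_ext def_true => E; split.
apply: def_ext (def_and (dF t) IH) => E; split.
  by move=> [Ft Fl] u; rewrite inE => /orP[/eqP->|/Fl].
by move=> H; split=> [|u ul]; apply: H; rewrite inE ?eqxx // ul orbT.
Qed.

Lemma def_con (s : seq nat) : definable (fun E => con (map E s)).
Proof.
(* A fresh index, to hold the quantified solution. *)
pose a := (\max_(i <- s) i).+1.
have sa i : i \in s -> i < a by move=> si; rewrite ltnS; apply: leq_bigmax_seq.
have H i : i \in s -> (i == a) = false by move=> /sa ia; rewrite ltn_eqF.
apply: (@def_ext (fun E => exists x, forall i, i \in s -> R (upd E a x a) (upd E a x i))).
  move=> E; split=> -[x xP]; exists x.
    by move=> p /mapP[i si ->]; have := xP i si; rewrite /upd eqxx H.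
  by move=> i si; rewrite /upd eqxx H //; apply: xP; apply: map_f.
apply: (@def_ex a (fun E => forall i, i \in s -> R (E a) (E i))).
(* [def_all] asks for definability at every index, including [i = a], where [def_at] does not
   apply. *)
apply: (@def_ext (fun E => forall i, i \in s -> if i == a then True else R (E a) (E i))).
  by move=> E; split=> K i si; have := K i si; rewrite H.
apply: def_all => i; case: eqVneq => [_|ia]; first exact: def_true.
by apply: def_at; rewrite eq_sym.
Qed.

Lemma def_separated (c : cotree nat) : definable (fun E => separated (cmap E c)).
Proof.
elim: c => [|i|a IHa b IHb|a IHa b IHb] /=; try exact: def_true.
  exact: def_and.
have := def_and (def_and IHa IHb) (def_all (leaves a) (fun i =>
          def_all (leaves b) (fun j => def_not (def_con [:: i; j])))).
apply: def_ext => E; split.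
  move=> [[sa sb] H]; split=> // p q; rewrite !leaves_cmap.
  by move=> /mapP[i ia ->] /mapP[j jb ->]; apply: H.
move=> [sa sb H]; split=> // i ia j jb; apply: H; rewrite leaves_cmap; exact: map_f.
Qed.

Lemma def_valid (c : cotree nat) : definable (fun E => valid (cmap E c)).
Proof.
apply: def_ext (def_and (def_all (cliques c) def_con) (def_separated c)) => E.
split=> -[H sc]; split=> // s; rewrite ?cliques_cmap.
  by case/mapP=> t tc ->; apply: H.
by move=> sc'; apply: H; rewrite cliques_cmap; apply: map_f.
Qed.

(* No definable relation in [R] has SOP_2, in a finitary form.  The blocks
   below [k] are the object variables, the others are the parameters. *)
Definition fork_free : Prop := forall k Q, definable Q -> exists N,
  forall Z : seq bool -> nat -> P,
  (forall s, size s = N -> exists Y, forall m, m <= N -> Q (env Y (Z (take m s)) k)) ->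
  exists s s' Y, [/\ size s <= N, size s' <= N, incomparable s s',
    Q (env Y (Z s) k) & Q (env Y (Z s') k)].

(** * Growing patterns inside combs *)

Section Collapse.
Variable p0 : P.
Hypothesis ff : fork_free.

(* The copy of [Top] at the end of a branch is a common solution of the nodes of
   that branch, hence by [fork_free] some copy solves two incomparable nodes. *)
Lemma merge C G Top : exists N,
  realizable (plug C (comb G Top N)) -> realizable (plug C (Csep Top (Cjoin G G))).
Proof.
set k := size (leaves Top).
(* Leaves of the hole come before those of the context, and those of [Top] before those of [G].
   Hence the indices below [k] in [number S 0] are the leaves of [Top], the object variables. *)
pose S := plug C (Csep Top G).
have [N HN] := ff k (def_valid (number S 0)).
(* Nodes of length up to [N] are needed, and tops sit one level higher. *)
exists N.+1 => -[c /plug_inv[Gam [f [-> GamC fS]]] vc].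
have [g [t [gG tT Xtg _ Jg]]] := comb_nodes fS.
pose Z s := nth p0 (leaves (g s) ++ flatten [seq leaves h.2 | h <- Gam]).
have key y s : cshp y = Top -> cshp (g s) = G ->
    cmap (env (nth p0 (leaves y)) (Z s) k) (number S 0) = plug Gam (Csep y (g s)).
  move=> yT gsG.
  have -> : S = cshp (plug Gam (Csep y (g s))).
    by rewrite plug_cshp /S GamC /cshp /= -/(cshp _) -/(cshp _) yT gsG.
  apply: cmap_number => p i; rewrite add0n => isz; rewrite (set_nth_default p0) //.
  rewrite leaves_plug /= -catA nth_cat /env /Z.
  by rewrite [size (leaves y)]size_leaves yT.
have [] := HN Z.
  move=> s sN; pose s' := rcons s false.
  have s'N : size s' = N.+1 by rewrite size_rcons sN.
  exists (nth p0 (leaves (t s'))) => m mN.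
  have ts : take m s = take m s' by rewrite /s' -cats1 takel_cat ?sN.
  rewrite ts key ?tT //; last first.
    by case: (gG (take m s')) => //; rewrite size_takel ?s'N ?ltnS // leqW.
  by apply: sub_valid vc; apply: sub_plug; apply: Xtg.
move=> s [s' [Y [sN s'N inc]]].
pose y := cmap Y (number Top 0).
have yT : cshp y = Top by rewrite cshp_cmap cshp_number.
have envY s1 : env Y (Z s1) k = env (nth p0 (leaves y)) (Z s1) k.
  apply/funext => i; rewrite /env; case: ltnP => // ik.
  by rewrite leaves_cmap leaves_number (nth_map 0) ?size_iota // nth_iota.
have [gs _] := gG s sN; have [gs' _] := gG s' s'N.
rewrite !envY !key // => v1 v2.
have vJ : valid (plug Gam (Cjoin (g s) (g s'))).
  by apply: sub_valid vc; apply: sub_plug; apply: Jg.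
exists (plug Gam (Csep y (Cjoin (g s) (g s')))).
  by rewrite plug_cshp GamC /cshp /= -!/(cshp _) yT gs gs'.
have vy : valid (plug Gam y) by apply: sub_valid v1; apply: sub_plug; auto.
(* A clique passes through [y] or through the merged pair. In the first case [v1] supplies a
   solution, in the second the original comb does, since the two nodes are incomparable. *)
split.
  by move=> q /cliques_plug_X[]; [case: vy => + _|case: vJ => + _]; apply.
apply: separated_plug_X; [by case: vy|by case: vJ|].
have [_ _ c1] : separated (Csep y (g s)) by apply: sub_separated (v1.2); apply: sub_in_plug.
have [_ _ c2] : separated (Csep y (g s')) by apply: sub_separated (v2.2); apply: sub_in_plug.
by move=> p q py /=; rewrite mem_cat => /orP[]; [apply: c1|apply: c2].
Qed.

Lemma comb_le G Top m n : m <= n -> sub (comb G Top m) (comb G Top n).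
Proof.
elim: n m => [|n IH] m; first by rewrite leqn0 => /eqP->.
rewrite leq_eqVlt => /orP[/eqP-> //|mn] /=.
by apply/sub_Xl/sub_Jl/IH.
Qed.

(** The two subcombs are treated in turn, each with the other as part of its context. [M2] is chosen
    first: it is the height that the right comb must still have after the left one has been
    transformed. *)
Lemma merge_top G Top L : forall C, exists M,
  realizable (plug C (comb G Top M)) -> realizable (plug C (comb G (Csep Top (Cjoin G G)) L)).
Proof.
elim: L => [|L IH] C; first exact: merge.
set c := comb G (Csep Top (Cjoin G G)) L in IH *.
have [M2 H2] := IH ((false, c) :: (true, G) :: C).
have [M1 H1] := IH ((false, comb G Top M2) :: (true, G) :: C).
exists (maxn M1 M2).+1 => H; apply: H2.
apply: (@realizable_sub _ (plug C (Csep (Cjoin c (comb G Top M2)) G))).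
  by apply: (@sub_plug _ C (Csep (Cjoin _ _) G)); apply: sub_X => //; apply: sub_Jsw.
apply: H1; apply: realizable_sub H; apply: (@sub_plug _ C (Csep (Cjoin _ _) G)); apply: sub_X => //.
by apply: sub_J; apply: comb_le; rewrite ?leq_maxl ?leq_maxr.
Qed.

(** Two consecutive nodes of a branch are inconsistent with each other and with all that lies above
    both, so they act as one node [Csep G G]; every new level therefore costs two old ones. *)
Lemma thick_comb G Top L : forall C, exists M,
  realizable (plug C (comb G Top M)) -> realizable (plug C (comb (Csep G G) Top L)).
Proof.
elim: L => [|L IH] C; first by exists 0.
set c := comb (Csep G G) Top L in IH *.
have [M2 H2] := IH ((false, c) :: (true, Csep G G) :: C).
have [M1 H1] := IH ((false, comb G Top M2) :: (true, Csep G G) :: C).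
exists (maxn M1 M2).+2 => H; apply: H2.
apply: (@realizable_sub _ (plug C (Csep (Cjoin c (comb G Top M2)) (Csep G G)))).
  by apply: (@sub_plug _ C (Csep (Cjoin _ _) (Csep G G))); apply: sub_X => //; apply: sub_Jsw.
apply: H1 => /=; apply: realizable_assoc; apply: realizable_sub H; apply: sub_plug => /=.
apply: sub_X => //; apply: sub_Jl; apply: sub_X => //.
by apply: sub_J; apply: comb_le; rewrite ?leq_maxl ?leq_maxr.
Qed.

Definition realizable_combs G := forall L, realizable (comb G Cemp L).

Lemma realizable_combs_sep G : realizable_combs G -> realizable_combs (Csep G G).
Proof. by move=> rG L; have [M H] := thick_comb G Cemp L [::]; apply: H (rG M). Qed.

(** The highest level of nodes is dropped, which leaves the tops in joined pairs. *)
Lemma comb_JJ G Top L : sub (comb G (Cjoin Top Top) L) (comb G Top L.+1).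
Proof. by elim: L => [|L IH] /=; auto. Qed.

Lemma realizable_combs_join G : realizable_combs G -> realizable_combs (Cjoin G G).
Proof.
move=> rG n.
(* A comb of [G] of arbitrary height stays below the new comb, since every further level of the new
   comb is obtained by merging nodes of [G]. *)
suff H : forall L, realizable (comb G (comb (Cjoin G G) Cemp n) L) by apply: (H 0).
elim: n => [|n IH] L //.
have [M H] := merge_top G (Cjoin (comb (Cjoin G G) Cemp n) (comb (Cjoin G G) Cemp n)) L [::].
by apply: H; apply: realizable_sub (comb_JJ _ _ _) (IH _).
Qed.

Lemma forks_collapse : ~ (forall n, realizable (forks n)).
Proof.
(* The relation is [R] itself: block 0 is the solution and block 1 the parameter. *)
move=> H; have [N HN] := ff 1 (@def_at 0 1 isT).
have fork_nodes n c : cshp c = forks n -> exists d : seq bool -> P,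
  [/\ forall s, size s < n -> d s \in leaves c,
      forall s, size s = n -> exists2 q, q \in cliques c & forall m, m < n -> d (take m s) \in q &
      separated c -> forall s s', size s < n -> size s' < n -> incomparable s s' ->
        ~ con [:: d s; d s']].
  elim: n c => [|n IH] c.
    move=> cO; exists (fun=> p0); split=> // s _.
    by have [q qc] := cliques_neq0 c; exists q.
  case: c => // -[] // p c1 /= []; case: c1 => // c0 c1 /= [/IH[d0 [l0 q0 s0]] /IH[d1 [l1 q1 s1]]].
  exists (fun s => match s with [::] => p | b :: s => if b then d1 s else d0 s end).
  split.
  - case=> [|b s] /=; first by rewrite inE eqxx.
    by rewrite ltnS inE mem_cat => sn; case: b; rewrite ?l1 ?l0 ?orbT.
  - case=> // b s [sn]; have [q qc qP] : exists2 q, q \in cliques c0 ++ cliques c1 &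
        forall m, m < n -> (if b then d1 else d0) (take m s) \in q.
      by case: b; [have [q qc qP] := q1 s sn|have [q qc qP] := q0 s sn];
        exists q; rewrite // mem_cat qc ?orbT.
    exists (p :: q); first by rewrite cats0 map_f.
    case=> [|m] mn /=; first by rewrite inE eqxx.
    by rewrite inE; have := qP m mn; case: b {qP} => ->; rewrite orbT.
  - case=> _ [sc0 sc1 cr] [|b s] [|b' s'] //; rewrite /= !ltnS => sn s'n.
    case: b b' => [] [] inc.
    + exact: s1.
    + move=> cn; apply: (cr (d0 s') (d1 s)); [exact: l0|exact: l1|].
      by apply: con_sub cn => x; rewrite !inE orbC.
    + by apply: cr; [apply: l0|apply: l1].
    + exact: s0.
have [c cN [vc sc]] := H N.+1.
have [d [_ dc ds]] := fork_nodes _ _ cN.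
have [] := HN (fun s _ => d s).
  move=> s sN; have [|q /vc[x xP] qP] := dc (rcons s false).
    by rewrite size_rcons sN.
  exists (fun=> x) => m mN; apply: xP; rewrite /env /=.
  by have := qP m mN; rewrite -cats1 takel_cat ?sN.
move=> s [s' [Y [sN s'N inc]]]; rewrite /env /= => R1 R2.
apply: (ds sc s s' sN s'N inc); exists (Y 0) => p.
by rewrite !inE => /orP[]/eqP->.
Qed.

Lemma comb_collapse : ~ (forall n, realizable (comb (Cpt tt) Cemp n)).
Proof.
move=> H; apply: forks_collapse => n.
have [G [rG _ fG]] : exists G, [/\ realizable_combs G, sub (Cpt tt) G & sub (forks n) G].
  elim: n => [|n [G [rG vG fG]]]; first by exists (Cpt tt); split; auto.
  (* One factor contributes the root of [forks n.+1], the other its two subtrees. *)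
  exists (Cjoin (Csep G G) (Csep G G)); split; auto.
  - exact/realizable_combs_join/realizable_combs_sep.
  - by rewrite /=; auto.
by apply: realizable_sub (rG 1); apply: sub_Xr.
Qed.

End Collapse.
End Valid.

Arguments Emp {K X}.
#[local] Hint Constructors emb : core.
#[local] Hint Resolve emb_refl : core.

(** * Consistent copies of a shape *)

Section Shapes.
Variable K : nat.
Local Notation I := 'I_K.
Local Notation tree := (tree K).

Definition isE X (t : tree X) : bool := if t is Emp then true else false.

Fixpoint narrow j X (t : tree X) : Prop :=
  match t with
  | Emp => True
  | Un _ t => narrow j t
  | Br f => #|[set i | ~~ isE (f i)]| <= j /\ forall i, narrow j (f i)
  end.

Lemma narrow_shp j X (t : tree X) : narrow j (shp t) <-> narrow j t.
Proof.
elim: t => //= f IH; split=> -[H1 H2]; split.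
- by rewrite (eq_card (B := [set i | ~~ isE (shp (f i))])) // => i; rewrite !inE; case: (f i).
- by move=> i; apply/IH/H2.
- by rewrite (eq_card (B := [set i | ~~ isE (f i)])) // => i; rewrite !inE; case: (f i).
- by move=> i; apply/IH/H2.
Qed.

Lemma narrow_max X (t : tree X) : narrow K t.
Proof.
elim: t => //= f IH; split=> //; by apply: leq_trans (max_card _) _; rewrite card_ord.
Qed.

Definition uns X (xs : seq X) (t : tree X) : tree X := foldr (@Un K X) t xs.

Lemma shp_uns X (t : tree X) m S : shp t = uns (nseq m tt) S ->
  exists xs t', [/\ t = uns xs t', size xs = m & shp t' = S].
Proof.
elim: m t => [|m IH] t /=; first by exists [::], t.
case/shp_Un=> x [t' [-> /IH[xs [u [-> <- uS]]]]].
by exists (x :: xs), u.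
Qed.

Lemma emb_uns X (xs : seq X) s t : emb s t -> emb (uns xs s) (uns xs t).
Proof. by elim: xs => //= x xs IH /IH; apply: emb_UnS. Qed.

Lemma emb_uns_r X (xs : seq X) s t : emb s t -> emb s (uns xs t).
Proof. by elim: xs => //= x xs IH /IH; apply: emb_Un. Qed.

Lemma uns_shp X (xs : seq X) t : shp (uns xs t) = uns (nseq (size xs) tt) (shp t).
Proof. by elim: xs => //= x xs <-. Qed.

Definition chain (Z : tree unit) : Prop := exists m, Z = uns (nseq m tt) Emp.

Definition BrX (D : {set I}) X (Z : tree X) : tree X :=
  Br (fun i => if i \in D then Z else Emp).

Lemma shp_unit (t : tree unit) : shp t = t.
Proof.
elim: t => //= [[] t|f] IH; rewrite /shp /=; first by rewrite -[in RHS]IH.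
by congr Br; apply/funext.
Qed.

Inductive context : (tree unit -> tree unit) -> Prop :=
  | ctx_id : context id
  | ctx_Un Phi : context Phi -> context (fun s => Phi (Un tt s))
  | ctx_Br Phi i g : context Phi -> context (fun s => Phi (Br (updI g i s))).

Lemma emb_updI X (f : I -> tree X) i s t : emb s t -> emb (Br (updI f i s)) (Br (updI f i t)).
Proof. by move=> st; apply: emb_BrS => k; rewrite /updI; case: eqP. Qed.

Lemma context_emb Phi S S' : context Phi -> emb S S' -> emb (Phi S) (Phi S').
Proof.
move=> cP; elim: cP S S' => //= [Phi' _ IH|Phi' i g _ IH] S S' SS'; apply: IH.
- exact: emb_UnS.
- exact: emb_updI.
Qed.

(** * Forced shapes *)

Section Labels.
Variable Y : eqType.

Fixpoint lab (X : Type) (t : tree X) : seq X :=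
  match t with
  | Emp => [::]
  | Un x t => x :: lab t
  | Br f => flatten [seq lab (f i) | i <- enum I]
  end.

Lemma lab_BrP (f : I -> tree Y) y : reflect (exists i, y \in lab (f i)) (y \in lab (Br f)).
Proof.
apply: (iffP flatten_mapP) => [[i _ ?]|[i ?]]; exists i => //.
by rewrite mem_enum.
Qed.

Lemma emb_lab (s t : tree Y) : emb s t -> {subset lab s <= lab t}.
Proof.
elim=> //= {s t} [x s t _ IH|x s t _ IH|f g _ IH|i s g _ IH] y.
- by rewrite !inE => /orP[->//|/IH ->]; rewrite orbT.
- by rewrite inE => /IH ->; rewrite orbT.
- by move/(@lab_BrP f)=> [i /IH yi]; apply/(@lab_BrP g); exists i.
- by move/IH => yi; apply/(@lab_BrP g); exists i.
Qed.

Lemma size_lab X (t : tree X) : size (lab t) = size (lab (shp t)).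
Proof.
elim: t => //= [x t ->//|f IH].
rewrite !size_flatten /shape -!map_comp; congr sumn.
by apply: eq_map => i /=; apply: IH.
Qed.

Lemma lab_uns (xs : seq Y) t : lab (uns xs t) = xs ++ lab t.
Proof. by elim: xs => //= x xs ->. Qed.

(** The bound on the labels outside the hole comes from [Phi] alone; it later bounds the length of
    conjunctions. *)
Lemma context_lift Phi : context Phi -> exists d, forall (c : tree Y) S, shp c = Phi S ->
  exists (Psi : tree Y -> tree Y) (p : tree Y) (F : seq Y),
  [/\ c = Psi p, shp p = S, size F <= d &
      [/\ forall z, shp (Psi z) = Phi (shp z),
          forall z z', emb z z' -> emb (Psi z) (Psi z') &
          forall z, lab (Psi z) =i F ++ lab z]].
Proof.
elim=> {Phi} [|Phi _ [d IH]|Phi i g _ [d IH]].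
- by exists 0 => c S cS; exists id, c, [::].
- exists d.+1 => c S /IH[Psi [_ [F [-> /shp_Un[x [p [-> pS]]] dF [H1 H2 H3]]]]].
  exists (fun z => Psi (Un x z)), p, (x :: F); split=> //; split.
  + by move=> z; rewrite H1.
  + by move=> z z' zz'; apply/H2/emb_UnS.
  + by move=> z y; rewrite H3 /= !(inE, mem_cat) orbCA.
- exists (d + size (lab (Br g))) => c S.
  move=> /IH[Psi [_ [F [-> /shp_Br[f [-> fS]] dF [H1 H2 H3]]]]].
  have fi : shp (f i) = S by rewrite fS updI_id.
  pose f0 := updI f i Emp.
  exists (fun z => Psi (Br (updI f i z))), (f i), (F ++ lab (Br f0)); split=> //.
  + by rewrite updI_same.
  + rewrite size_cat leq_add //; rewrite !size_flatten /shape -!map_comp.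
    rewrite !sumnE !big_map; apply: leq_sum => k _ /=.
    rewrite /f0 /updI; case: eqP => // ki; rewrite size_lab fS /updI.
    by move/eqP/negPf: ki => ->.
  + split.
    * move=> z; rewrite H1 /shp /=; congr (Phi (Br _)); apply/funext => k.
      rewrite /updI; case: eqP => // ki; have := fS k.
      by rewrite /updI; move/eqP/negPf: ki => ->.
    * by move=> z z' zz'; apply/H2/emb_updI.
    * move=> z y; rewrite H3 !mem_cat -orbA; congr orb.
      apply/lab_BrP/orP => [[k]|[/lab_BrP[k]|yz]].
      -- rewrite /updI; case: (k =P i) => [_|ki yk]; first by right.
         by left; apply/lab_BrP; exists k; rewrite /f0 /updI; move/eqP/negPf: ki => ->.
      -- rewrite /f0 /updI; case: (k =P i) => // ki yk.
         by exists k; move/eqP/negPf: ki => ->.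
      -- by exists i; rewrite updI_id.
Qed.

Hypothesis K_gt1 : 1 < K.
Let K_gt0 : 0 < K := ltnW K_gt1.

Variables (P : eqType) (r : P -> Y -> Prop).

Definition Con (s : seq Y) : Prop := exists x, forall y, y \in s -> r x y.

Lemma Con_sub s t : {subset s <= t} -> Con t -> Con s.
Proof. by move=> st [x H]; exists x => p /st; apply: H. Qed.

Definition chains_consistent (t : tree Y) : Prop := forall z, emb z t -> narrow 1 z -> Con (lab z).

Definition forced (S : tree unit) : Prop := exists N, forall t, full N t -> chains_consistent t ->
  exists s, [/\ emb s t, shp s = S & Con (lab s)].

Lemma chains_consistent_emb s t : emb s t -> chains_consistent t -> chains_consistent s.
Proof. by move=> st gt z zs; apply: gt; apply: emb_trans zs st. Qed.

Lemma forced_emb S S' : emb S S' -> forced S' -> forced S.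
Proof.
move=> SS' [N H]; exists N => t ft gt; have [s [st sS cs]] := H t ft gt.
have [s' [s's s'S]] : exists s', emb s' s /\ shp s' = S by apply: emb_lift; rewrite sS.
exists s'; split=> //; first exact: emb_trans st.
by apply: Con_sub cs; apply: emb_lab.
Qed.

Definition forced_in (A : tree unit -> Prop) (Phi : tree unit -> tree unit) : Prop :=
  forall Z, A Z -> forced (Phi Z).

(** Of the two colours in [ramsey_all], the inconsistent one is impossible for a forced shape, which
    has a consistent copy in every large enough full tree with consistent chains. *)
Lemma homogeneous_subtree (A : tree unit -> Prop) (l : nat -> tree unit) k n :
  (forall S, A S -> forced S) -> exists N, forall t, full N t -> chains_consistent t ->
  exists t', [/\ emb t' t, full n t' &
    forall j, j < k -> A (l j) -> forall s, emb s t' -> shp s = l j -> Con (lab s)].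
Proof.
move=> AC; elim: k => [|k [N0 IH]].
  by exists n => t ft gt; exists t.
have [Ak|nAk] := EM (A (l k)); last first.
  exists N0 => t ft gt; have [t' [e' f' H]] := IH t ft gt; exists t'; split=> //.
  move=> j; rewrite ltnS leq_eqVlt => /orP[/eqP->//|]; exact: H.
have [N1 HN1] := AC _ Ak.
have [N HN] := @ramsey_all K K_gt0 Y (l k) (maxn N0 N1).
exists N => t ft gt; have [t1 [e1 f1 h1]] := HN t (fun s => Con (lab s)) ft.
have g1 := chains_consistent_emb e1 gt.
have h1' s : emb s t1 -> shp s = l k -> Con (lab s).
  case: h1 => [|no]; first exact.
  have [u [eu fu]] := full_trunc (leq_maxr N0 N1) f1.
  have [s0 [es0 ss0 cs0]] := HN1 u fu (chains_consistent_emb eu g1).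
  by case: (no s0 (emb_trans es0 eu) ss0).
have [u [eu fu]] := full_trunc (leq_maxl N0 N1) f1.
have [t' [e' f' H]] := IH u fu (chains_consistent_emb eu g1).
have e'1 := emb_trans e' eu.
exists t'; split=> //; first exact: emb_trans e'1 e1.
move=> j; rewrite ltnS leq_eqVlt => /orP[/eqP-> _ s st|]; last exact: H.
by apply: h1'; apply: emb_trans st e'1.
Qed.

(** A failure at [S'] yields trees [p] of any desired shape in which all copies of [S'] fail over
    [F] while shapes in [A] still succeed. Such trees carry the patterns that [fork_free]
    refutes. *)
Lemma homogeneous_context Phi : context Phi -> exists d, forall (A : tree unit -> Prop) S S',
  forced_in A Phi -> ~ forced (Phi S') -> exists p F,
  [/\ shp p = S, size F <= d,
      forall z, emb z p -> A (shp z) -> Con (F ++ lab z) &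
      forall z, emb z p -> shp z = S' -> ~ Con (F ++ lab z)].
Proof.
move=> cP; have [d dP] := context_lift cP; exists d => A S S' hA nC.
(* Only finitely many shapes occur inside [S], so finitely many homogenizations suffice. *)
have [k /(_ S (shp_unit S))[l lP]] := finite_subtrees unit S.
have [n0 n0P] := full_contains K_gt0 Y (Phi S).
have [] := @homogeneous_subtree (fun Q => exists2 Z, A Z & Q = Phi Z) (fun j => Phi (l j)) k n0.
  by move=> _ [Z AZ ->]; apply: hA.
move=> N HN.
(* As [Phi S'] is not forced, there is a counterexample at the height [N] that homogenization asks
   for. *)
have [t [ft gt no]] : exists t : tree Y, [/\ full N t, chains_consistent t &
    forall s, emb s t -> shp s = Phi S' -> ~ Con (lab s)].
  apply: contrapT => H; apply: nC; exists N => t ft gt; apply: contrapT => no.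
  apply: H; exists t; split=> // s es ss cs; apply: no; by exists s.
have [t' [e' f' Ht']] := HN t ft gt.
have [c [ec cS]] := n0P t' f'.
have [Psi [p [F [cE pS dF [H1 H2 H3]]]]] := dP c S cS.
exists p, F; split=> // z zp.
  move=> Az; have [j jk zj] : exists2 j, j < k & shp z = l j.
    by apply: lP; rewrite -pS; apply: emb_shp.
  have eF : {subset F ++ lab z <= lab (Psi z)} by move=> y; rewrite H3.
  apply: Con_sub eF (Ht' j jk _ (Psi z) _ _).
  - by exists (shp z) => //; rewrite zj.
  - by apply: emb_trans ec; rewrite cE; apply: H2.
  - by rewrite H1 zj.
move=> zS; have eF : {subset lab (Psi z) <= F ++ lab z} by move=> y; rewrite H3.
move=> /(Con_sub eF); apply: no; last by rewrite H1 zS.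
by apply: emb_trans e'; apply: emb_trans ec; rewrite cE; apply: H2.
Qed.

Lemma superset_card (D : {set I}) j : #|D| <= j -> j <= K ->
  exists2 D' : {set I}, D \subset D' & #|D'| = j.
Proof.
move=> Dj jK; rewrite -(subnKC Dj); move: (j - _) (subnKC Dj) => e.
elim: e j D {Dj} jK => [|e IH] j D jK De; first by exists D; rewrite ?addn0.
have [i iD] : exists i, i \notin D.
  apply: contrapT => H; suff DK : #|D| = K.
    by move: jK; rewrite -De DK addnS -ltn_subRL subnn.
  have -> : D = setT; last by rewrite cardsT card_ord.
  apply/setP => i; rewrite inE; apply: contrapT => iD; apply: H; exists i; exact/negP.
have ci : #|i |: D| = #|D|.+1 by rewrite cardsU1 iD.
have [D' DD' cD'] := IH j (i |: D) jK (etrans (congr1 (addn^~ e) ci) (etrans (addSnnS _ _) De)).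
exists D'; first by apply: subset_trans DD'; apply: subsetUr.
by rewrite cD' ci addSnnS.
Qed.

(** Structural induction with varying context. At a branching, children from [A] are exchanged for
    the prescribed ones one direction at a time, the other directions counting as context. *)
Lemma extend (A : tree unit -> Prop) j :
  A Emp -> (forall Z, A Z -> A (Un tt Z)) ->
  (forall Z1 Z2, A Z1 -> A Z2 -> exists Z, [/\ A Z, emb Z1 Z & emb Z2 Z]) ->
  j <= K ->
  (forall Phi, context Phi -> forced_in A Phi -> forall (D : {set I}) Z, #|D| = j -> A Z ->
     forced (Phi (BrX D Z))) ->
  forall Phi, context Phi -> forced_in A Phi -> forced_in (narrow j (X := unit)) Phi.
Proof.
move=> AE AU Adir jK split Phi cP hP Z.
elim: Z Phi cP hP => [|[] Z IH|f IH] Phi cP hP /=; first by move=> _; apply: hP.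
  move=> nZ; apply: (IH (fun s => Phi (Un tt s))) => //; first exact: ctx_Un.
  by move=> Z' AZ'; apply/hP/AU.
move=> [supp nf]; have [D sD cD] := superset_card supp jK.
(* [s] lists the directions that carry their prescribed child. When it is empty, all children embed
   in a single [Z] from [A], and [split] applies. *)
suff aux : forall s : seq I, forall g,
    (forall i, i \in s -> g i = f i) -> (forall i, i \notin s -> A (g i)) ->
    (forall i, i \notin D -> g i = Emp) -> forced (Phi (Br g)).
  apply: (aux (enum I)) => // [i|i iD]; first by rewrite mem_enum.
  apply: contrapT => fi; case/negP: iD; apply: (subsetP sD); rewrite inE.
  by case: (f i) fi.
elim=> [|i s IHs] g gs gA gD.
  have [Z [AZ gZ]] : exists Z, A Z /\ forall i, i \in enum I -> emb (g i) Z.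
    elim: (enum I) => [|i s [Z [AZ sZ]]]; first by exists Emp.
    have [Z' [AZ' e1 e2]] := Adir _ _ AZ (gA i isT).
    exists Z'; split=> // k; rewrite inE => /orP[/eqP->//|/sZ kZ].
    exact: emb_trans e1.
  apply: forced_emb (split _ cP hP D Z cD AZ); apply: context_emb => //.
  apply: emb_BrS => i; case: ifPn => [_|/gD->//]; apply: gZ; by rewrite mem_enum.
have [is_|is_] := boolP (i \in s).
  apply: IHs => // [k ks|k ks]; first by apply: gs; rewrite inE ks orbT.
  by apply: gA; rewrite inE negb_or ks andbT; apply: contraNneq ks => ->.
have [iD|iD] := boolP (i \in D); last first.
  apply: IHs => // [k ks|k ks]; first by apply: gs; rewrite inE ks orbT.
  have [->|ki] := eqVneq k i; first by rewrite gD.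
  by apply: gA; rewrite inE negb_or ki.
rewrite -(updI_same g i) (gs i (mem_head _ _)).
apply: (IH i (fun z => Phi (Br (updI g i z)))) => //; first exact: ctx_Br.
move=> Z AZ; apply: IHs => k; rewrite /updI; case: (eqVneq k i) => [->|ki] //.
- by rewrite (negPf is_).
- by move=> ks; apply: gs; rewrite inE ks orbT.
- by move=> ks; apply: gA; rewrite inE negb_or ki.
- by rewrite iD.
- exact: gD.
Qed.

(* [th D] is a single parameter coding the conjunction over [D]. *)
Definition tame : Prop := forall d, exists (R : P -> P -> Prop) (th : seq Y -> P),
  fork_free R /\ forall D, 0 < size D <= d -> forall x, R x (th D) <-> forall y, y \in D -> r x y.

Hypothesis Htame : tame.


Section Points.
Variables (d : nat) (R : P -> P -> Prop) (th : seq Y -> P).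
Hypothesis thP : forall D, 0 < size D <= d ->
  forall x, R x (th D) <-> forall y, y \in D -> r x y.

Lemma Con_con (q : seq P) W :
  (forall p, p \in q -> exists D, [/\ 0 < size D <= d, p = th D & {subset D <= W}]) ->
  Con W -> con R q.
Proof.
move=> H [x xW]; exists x => p /H[D [Dd -> DW]].
by apply/thP => // y /DW; apply: xW.
Qed.

Lemma con_Con D1 D2 : 0 < size D1 <= d -> 0 < size D2 <= d ->
  con R [:: th D1; th D2] -> Con (D1 ++ D2).
Proof.
move=> d1 d2 [x xP]; exists x => y; rewrite mem_cat => /orP[].
- by apply: (thP d1 x).1; apply: xP; rewrite inE eqxx.
- by apply: (thP d2 x).1; apply: xP; rewrite !inE eqxx orbT.
Qed.

End Points.

Lemma card2_set (D : {set I}) : #|D| = 2 -> exists a b, a != b /\ D = [set a; b].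
Proof. by move/eqP/cards2P => [a [b [ab ->]]]; exists a, b. Qed.

Definition two X a b (s t : tree X) : tree X :=
  Br (fun i => if i == a then s else if i == b then t else Emp).

Lemma two_BrX a b (s t : tree Y) Z : shp s = Z -> shp t = Z ->
  shp (two a b s t) = BrX [set a; b] Z.
Proof.
move=> sZ tZ; rewrite /shp /=; congr Br; apply/funext => i; rewrite !inE.
by case: eqP => //=; case: eqP.
Qed.

Lemma emb_two a b (f : I -> tree Y) s t : a != b -> emb s (f a) -> emb t (f b) ->
  emb (two a b s t) (Br f).
Proof.
move=> ab sa tb; apply: emb_BrS => i; case: eqP => [->//|_].
by case: eqP => [->//|_]; apply: emb_E.
Qed.

Lemma lab_two a b (s t : tree Y) : a != b ->
  {subset lab s ++ lab t <= lab (two a b s t)}.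
Proof.
move=> ab y; rewrite mem_cat => /orP[ys|yt]; apply/lab_BrP; [exists a|exists b].
- by rewrite eqxx.
- by rewrite eq_sym (negPf ab) eqxx.
Qed.

Fixpoint chain_tree a b m n : tree unit :=
  if n is n'.+1 then uns (nseq m tt) (two a b (chain_tree a b m n') (chain_tree a b m n'))
  else Emp.

(** A point is [F] together with a block of [m] labels. Blocks along a branch form a chain, while
    blocks on both sides of a branching form the excluded shape. *)
Lemma forks_of_chain_tree d (R : P -> P -> Prop) th (F : seq Y) a b m :
  (forall D, 0 < size D <= d -> forall x, R x (th D) <-> forall y, y \in D -> r x y) ->
  a != b -> 0 < m -> size F + m <= d -> forall n p, shp p = chain_tree a b m n ->
  (forall z, emb z p -> chain (shp z) -> Con (F ++ lab z)) ->
  (forall z, emb z p -> shp z = BrX [set a; b] (uns (nseq m tt) Emp) -> ~ Con (F ++ lab z)) ->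
  realizable R (forks n).
Proof.
move=> thP ab m0 Fd n p pS cons inc.
suff [c [cS _ cq sc]] : exists c, [/\ cshp c = forks n,
   forall v, v \in leaves c -> exists z, [/\ emb z p, shp z = uns (nseq m tt) Emp & v = th (F ++ lab z)],
   forall q, q \in cliques c -> exists z, [/\ emb z p, chain (shp z) & forall v, v \in q ->
     exists D, [/\ 0 < size D <= d, v = th D & {subset D <= F ++ lab z}]]
   & separated R c].
  exists c => //; split=> // q /cq[z [zp zc zq]].
  by apply: (Con_con thP zq); apply: cons.
elim: n p pS cons inc => [|n IH] p /= pS cons inc.
  exists Cemp; split=> // q; rewrite inE => /eqP->; exists Emp; split=> //.
  by exists 0.
have [xs [t' [pE xsm /shp_Br[f [t'Emp fS]]]]] := shp_uns pS; subst p t'.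
have efp i z : emb z (f i) -> emb z (uns xs (Br f)).
  by move=> e; apply/emb_uns_r; apply: emb_Br e.
have fa : shp (f a) = chain_tree a b m n by rewrite fS eqxx.
have fb : shp (f b) = chain_tree a b m n by rewrite fS eq_sym (negPf ab) eqxx.
have [] := IH (f a) fa.
- by move=> z /efp; apply: cons.
- by move=> z /efp; apply: inc.
move=> c0 [c0S l0 q0 s0]; have [] := IH (f b) fb.
- by move=> z /efp; apply: cons.
- by move=> z /efp; apply: inc.
move=> c1 [c1S l1 q1 s1].
have size_chain (z : tree Y) : shp z = uns (nseq m tt) Emp -> 0 < size (F ++ lab z) <= d.
  move=> /shp_uns[ys [t [-> ysm /shp_E ->]]].
  by rewrite lab_uns cats0 size_cat ysm Fd andbT addn_gt0 m0 orbT.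
have xsz : 0 < size (F ++ xs) <= d.
  by rewrite size_cat xsm Fd andbT addn_gt0 m0 orbT.
exists (Cjoin (Cpt (th (F ++ xs))) (Csep c0 c1)); split.
- by rewrite /cshp /= -!/(cshp _) c0S c1S.
- move=> v; rewrite /= inE mem_cat => /or3P[/eqP->|/l0[z [/efp ? ? ?]]|/l1[z [/efp ? ? ?]]];
    try by exists z.
  exists (uns xs Emp); split; first exact: emb_uns.
    by rewrite uns_shp xsm.
  by rewrite lab_uns cats0.
- move=> q /=; rewrite cats0 => /mapP[q' qc ->].
  have [z [zi [k zk] zq]] : exists z, [/\ exists i, emb z (f i), chain (shp z) & forall v, v \in q' ->
     exists D, [/\ 0 < size D <= d, v = th D & {subset D <= F ++ lab z}]].
    move: qc; rewrite mem_cat => /orP[/q0|/q1] [z [zp zc zq]]; exists z; split=> //.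
    * by exists a.
    * by exists b.
  case: zi => i zi; exists (uns xs z); split.
  + by apply: emb_uns; apply: emb_Br zi.
  + by exists (size xs + k); rewrite uns_shp zk nseqD /uns foldr_cat.
  + move=> v; rewrite inE => /orP[/eqP->|/zq[D [Dd vD Dz]]].
      exists (F ++ xs); split=> // y; rewrite lab_uns !mem_cat.
      by case/orP=> ->; rewrite ?orbT.
    exists D; split=> // y /Dz; rewrite lab_uns !mem_cat.
    by case/orP=> ->; rewrite ?orbT.
- split=> //; split=> // u v /l0[z0 [e0 z0S ->]] /l1[z1 [e1 z1S ->]].
  move=> /(con_Con thP (size_chain _ z0S) (size_chain _ z1S)) cz.
  apply: (inc (two a b z0 z1)).
  + by apply: emb_uns_r; apply: emb_two.
  + exact: two_BrX.
  + apply: Con_sub cz => y; rewrite !mem_cat => /orP[->//|].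
    case/lab_BrP=> i; case: eqP => [_ ->|_]; first by rewrite orbT.
    by case: eqP => // _ ->; rewrite !orbT.
Qed.

(* Otherwise blocks of a chain form a SOP_2 pattern. *)
Lemma split_chain Phi : context Phi -> forced_in chain Phi -> forall (D : {set I}) Z,
  #|D| = 2 -> chain Z -> forced (Phi (BrX D Z)).
Proof.
move=> cP hP D Z /card2_set[a [b [ab ->]]] [m ->].
(* Lengthening the chain makes blocks nonempty, as [th] requires. *)
suff H : forced (Phi (BrX [set a; b] (uns (nseq m.+1 tt) Emp))).
  apply: forced_emb H; apply: context_emb => //; apply: emb_BrS => i.
  by case: ifP => // _; apply: emb_Un.
apply: contrapT => nC; have [d dP] := homogeneous_context cP.
have [R [th [ffR thP]]] := Htame (d + m.+1).
apply: (forks_collapse (th [::]) ffR) => n.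
have [p [F [pS dF cons inc]]] := dP chain (chain_tree a b m.+1 n) _ hP nC.
by apply: (forks_of_chain_tree thP ab _ _ pS cons inc); rewrite // leq_add2r.
Qed.

(* Direction [x0] carries the rest of the tree, the other directions of [D] carry
   the copies of [Z] that form the point at the root; adding any later copy of
   [Z] gives [BrX D Z]. *)
Fixpoint comb_tree a b x0 (D : {set I}) Z n : tree unit :=
  if n is n'.+1 then
    Br (updI (fun i => if i \in D then Z else Emp) x0
         (two a b (comb_tree a b x0 D Z n') (comb_tree a b x0 D Z n')))
  else Emp.

(** A point fills [j] of the [j.+1] directions of [D], hence is consistent over [F]. Joining two
    sides by [two a b] stays within width [j] because [j > 1]. *)
Lemma comb_of_comb_tree d (R : P -> P -> Prop) th (F : seq Y) a b j x0 (D : {set I}) Z :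
  (forall s, 0 < size s <= d -> forall x, R x (th s) <-> forall y, y \in s -> r x y) ->
  a != b -> 1 < j -> x0 \in D -> #|D| = j.+1 -> narrow j Z -> 0 < size (lab Z) ->
  size F + size (lab (Br (updI (fun i => if i \in D then Z else Emp) x0 Emp))) <= d ->
  forall n p, shp p = comb_tree a b x0 D Z n ->
  (forall z, emb z p -> narrow j (shp z) -> Con (F ++ lab z)) ->
  (forall z, emb z p -> shp z = BrX D Z -> ~ Con (F ++ lab z)) ->
  realizable R (comb (Cpt tt) Cemp n).
Proof.
move=> thP ab j1 x0D cD nZ Z0 Fd n p pS cons inc.
(* For a leaf it is enough to remember one copy of [Z] inside its point: that copy completes any
   earlier point to [BrX D Z]. *)
suff [c [cS _ cq sc]] : exists c, [/\ cshp c = comb (Cpt tt) Cemp n,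
   forall v, v \in leaves c -> exists z D', [/\ emb z p, shp z = Z, 0 < size D' <= d,
      v = th D' & {subset F ++ lab z <= D'}],
   forall q, q \in cliques c -> exists z, [/\ emb z p, narrow j z & forall v, v \in q ->
     exists D, [/\ 0 < size D <= d, v = th D & {subset D <= F ++ lab z}]]
   & separated R c].
  exists c => //; split=> // q /cq[z [zp zc zq]].
  by apply: (Con_con thP zq); apply: cons => //; apply/narrow_shp.
elim: n p pS cons inc => [|n IH] p /= pS cons inc.
  by exists Cemp; split=> // q; rewrite inE => /eqP->; exists Emp; split.
have [f [pE fS]] := shp_Br pS; subst p.
have [h [fx0 hS]] : exists h, f x0 = Br h /\ forall i, shp (h i) =
    if i == a then comb_tree a b x0 D Z n else if i == b then comb_tree a b x0 D Z n else Emp.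
  by apply: shp_Br; rewrite fS updI_id.
have ehp i z : emb z (h i) -> emb z (f x0).
  by move=> e; rewrite fx0; apply: emb_Br e.
have efp i z : emb z (f i) -> emb z (Br f) by move=> e; apply: emb_Br e.
have ha : shp (h a) = comb_tree a b x0 D Z n by rewrite hS eqxx.
have hb : shp (h b) = comb_tree a b x0 D Z n by rewrite hS eq_sym (negPf ab) eqxx.
have [] := IH (h a) ha.
- by move=> z /ehp/efp; apply: cons.
- by move=> z /ehp/efp; apply: inc.
move=> c0 [c0S l0 q0 s0]; have [] := IH (h b) hb.
- by move=> z /ehp/efp; apply: cons.
- by move=> z /ehp/efp; apply: inc.
move=> c1 [c1S l1 q1 s1].
pose zr := Br (updI f x0 Emp).
have [i1 [i1D i1x]] : exists i, i \in D /\ i != x0.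
  have : 0 < #|D :\ x0| by move: cD; rewrite (cardsD1 x0) x0D add1n => -[->]; apply: ltnW.
  by case/card_gt0P=> i; rewrite !inE => /andP[? ?]; exists i.
have fi1 : shp (f i1) = Z by rewrite fS /updI (negPf i1x) i1D.
have shp_zr : shp zr = Br (updI (fun i => if i \in D then Z else Emp) x0 Emp).
  rewrite /shp /=; congr Br; apply/funext => i; have := fS i.
  by rewrite /updI; case: eqP.
have ezr : emb zr (Br f).
  by apply: emb_BrS => i; rewrite /updI; case: eqP => // _; apply: emb_E.
have zr1 : {subset lab (f i1) <= lab zr}.
  by move=> y yi; apply/lab_BrP; exists i1; rewrite /updI (negPf i1x).
have zsz : 0 < size (F ++ lab zr) <= d.
  rewrite size_cat size_lab shp_zr Fd andbT addn_gt0; apply/orP; right.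
  rewrite -shp_zr -size_lab.
  have : 0 < size (lab (f i1)) by rewrite size_lab fi1.
  by case: (lab (f i1)) zr1 => // y l /(_ y (mem_head _ _)) + _; case: (lab zr).
have nzr : narrow j zr.
  apply/narrow_shp; rewrite shp_zr; split; last first.
    by move=> i; rewrite /updI; case: eqP => // _; case: ifP.
  apply: (@leq_trans #|D :\ x0|).
    apply: subset_leq_card; apply/subsetP => i; rewrite !inE /updI.
    by case: eqP => // _; case: (i \in D).
  by move: cD; rewrite (cardsD1 x0) x0D add1n => -[->].
exists (Csep (Cjoin c0 c1) (Cpt (th (F ++ lab zr)))); split.
- by rewrite /cshp /= -!/(cshp _) c0S c1S.
- move=> v; rewrite /= !(mem_cat, inE) -orbA.
  case/or3P=> [/l0|/l1|/eqP->]; try by move=> [z [D' [/ehp/efp ? ? ? ? ?]]]; exists z, D'.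
  exists (f i1), (F ++ lab zr); split=> //; first exact: efp.
  by move=> y; rewrite !mem_cat => /orP[->//|/zr1->]; rewrite orbT.
- move=> q /=; rewrite mem_cat inE => /orP[/allpairsP[[u0 u1] /= [/q0 + /q1 + ->]]|/eqP->].
    move=> [z0 [e0 n0 u0P]] [z1 [e1 n1 u1P]].
    exists (two a b z0 z1); split.
    + by apply: (efp x0); rewrite fx0; apply: emb_two.
    + split; last by move=> i; case: ifP => // _; case: ifP.
      have c2 : #|[set a; b]| = 2 by rewrite cards2 ab.
      apply: leq_trans j1; rewrite -c2.
      apply: subset_leq_card; apply/subsetP => i; rewrite !inE.
      by case: eqP => //= _; case: eqP.
    + have sub2 := @lab_two a b z0 z1 ab.
      move=> v; rewrite mem_cat => /orP[/u0P|/u1P] [D' [? ? H]]; exists D'; split=> // y /H;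
        by rewrite !mem_cat => /orP[->//|yz]; rewrite sub2 ?orbT // mem_cat yz ?orbT.
  exists zr; split=> // v; rewrite inE => /eqP->; exists (F ++ lab zr); split=> //.
- split=> // u v ul; rewrite inE => /eqP->.
  have [z [D' [zx zS Dd -> zD]]] : exists z D', [/\ emb z (f x0), shp z = Z,
      0 < size D' <= d, u = th D' & {subset F ++ lab z <= D'}].
    by move: ul; rewrite /= mem_cat => /orP[/l0|/l1] [z [D' [/ehp ? ? ? ? ?]]]; exists z, D'.
  (* The later copy of [Z] is put into the free direction [x0] of [zr]. *)
  move=> /(con_Con thP Dd zsz) cz; apply: (inc (Br (updI f x0 z))).
  + by apply: emb_BrS => i; rewrite /updI; case: eqP => [->|].
  + rewrite /shp /=; congr Br; apply/funext => i; have := fS i; rewrite /updI.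
    by case: eqP => [-> _|//]; rewrite x0D.
  + apply: Con_sub cz => y; rewrite mem_cat => /orP[yF|].
      by rewrite mem_cat zD // mem_cat yF.
    case/lab_BrP=> i; rewrite /updI; case: eqP => [_ yz|ix yi].
      by rewrite mem_cat zD // mem_cat yz orbT.
    rewrite !mem_cat; apply/or3P; apply: Or33; apply/lab_BrP; exists i.
    by rewrite /updI; case: eqP ix.
Qed.

(* Otherwise sets of [j] siblings are inconsistent when comparable and
   consistent when incomparable. *)
Lemma split_narrow j Phi : 1 < j -> context Phi -> forced_in (narrow j (X := unit)) Phi ->
  forall (D : {set I}) Z, #|D| = j.+1 -> narrow j Z -> forced (Phi (BrX D Z)).
Proof.
(* The extra label makes [Z], and hence every point, nonempty. *)
move=> j1 cP hP D Z0 cD nZ0; pose Z := Un tt Z0.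
suff H : forced (Phi (BrX D Z)).
  apply: forced_emb H; apply: context_emb => //; apply: emb_BrS => i.
  by case: ifP => // _; apply: emb_Un.
have nZ : narrow j Z by [].
apply: contrapT => nC; have [d dP] := homogeneous_context cP.
have [x0 x0D] : exists x0, x0 \in D by apply/card_gt0P; rewrite cD.
pose a : I := Ordinal K_gt0; pose b : I := Ordinal K_gt1.
have ab : a != b by [].
have [R [th [ffR thP]]] :=
  Htame (d + size (lab (Br (updI (fun i => if i \in D then Z else Emp) x0 Emp)))).
apply: (comb_collapse (th [::]) ffR) => n.
have [p [F [pS dF cons inc]]] := dP (narrow j (X := unit)) (comb_tree a b x0 D Z n) _ hP nC.
by apply: (comb_of_comb_tree thP ab j1 x0D cD nZ _ _ pS cons inc); rewrite // leq_add2r.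
Qed.

(** The width grows by one at a time up to [K]. The first step starts from [chain], directed by
    concatenation; later ones direct [narrow j] by branching into two, which needs [j > 1]. *)
Theorem every_shape_consistent S : forced S.
Proof.
have h1 : forced_in chain id.
  move=> _ [m ->]; have [N HN] := full_contains K_gt0 Y (uns (nseq m tt) Emp).
  exists N => t ft gt; have [s [es ss]] := HN t ft; exists s; split=> //.
  apply: gt => //; apply/narrow_shp; rewrite ss.
  by elim: m {HN ss}.
have h2 : forced_in (narrow 2 (X := unit)) id.
  apply: (@extend chain) => //; try exact: ctx_id; last exact: split_chain.
  - by exists 0.
  - by move=> _ [m ->]; exists m.+1.
  - move=> _ _ [m1 ->] [m2 ->]; exists (uns (nseq (m1 + m2) tt) Emp); split.
    + by exists (m1 + m2).
    + by rewrite nseqD /uns foldr_cat; apply: emb_uns.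
    + by rewrite nseqD /uns foldr_cat; apply: emb_uns_r.
have hj j : 1 < j <= K -> forced_in (narrow j (X := unit)) id.
  elim: j => // j IH /andP[j1 jK]; move: j1; rewrite ltnS leq_eqVlt => /orP[/eqP<-//|j1].
  apply: (@extend (narrow j (X := unit))) => //; try exact: ctx_id.
  - move=> Z1 Z2 n1 n2; pose a : I := Ordinal K_gt0; pose b : I := Ordinal K_gt1.
    exists (two a b Z1 Z2); split.
    + split; last by move=> i; case: ifP => // _; case: ifP.
      have c2 : #|[set a; b]| = 2 by rewrite cards2.
      apply: leq_trans j1; rewrite -c2.
      apply: subset_leq_card; apply/subsetP => i; rewrite !inE.
      by case: eqP => //= _; case: eqP.
    + by apply: (emb_Br (i := a)); rewrite eqxx.
    + by apply: (emb_Br (i := b)).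
  - by move=> Phi cP hP; apply: split_narrow.
  - by apply: IH; rewrite j1 ltnW.
by apply: (hj K); rewrite ?K_gt1 ?leqnn //; apply: narrow_max.
Qed.

End Labels.
End Shapes.

(** * Renaming of variables and ultrapowers *)

Section Syntax.
Variable L : signature.

Fixpoint every T (P : T -> Prop) (s : seq T) : Prop :=
  if s is x :: s' then P x /\ every P s' else True.

Lemma term_nested_ind (P : term L -> Prop) :
  (forall i, P (Var L i)) -> (forall f ts, every P ts -> P (App f ts)) -> forall t, P t.
Proof.
move=> PV PA; fix IH 1 => -[i|f ts]; first exact: PV.
by apply: PA; elim: ts => //= t ts IHts; split.
Qed.

Fixpoint tren (f : nat -> nat) (t : term L) : term L :=
  match t with
  | Var i => Var L (f i)
  | App g ts => App g (map (tren f) ts)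
  end.

(* Bound variables are renamed as well, so injectivity of [f] rules out capture. *)
Fixpoint ren (f : nat -> nat) (p : formula L) : formula L :=
  match p with
  | Fal => Fal L
  | Eq t u => Eq (tren f t) (tren f u)
  | Rel r ts => Rel r (map (tren f) ts)
  | Not q => Not (ren f q)
  | And q r => And (ren f q) (ren f r)
  | Or q r => Or (ren f q) (ren f r)
  | Imp q r => Imp (ren f q) (ren f r)
  | Ex x q => Ex (f x) (ren f q)
  | All x q => All (f x) (ren f q)
  end.

Fixpoint term_vars_lt (B : nat) (t : term L) : bool :=
  match t with
  | Var i => i < B
  | App _ ts => all (term_vars_lt B) ts
  end.

Fixpoint vars_lt (B : nat) (p : formula L) : bool :=
  match p with
  | Fal => true
  | Eq t u => term_vars_lt B t && term_vars_lt B u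
  | Rel _ ts => all (term_vars_lt B) ts
  | Not q => vars_lt B q
  | And q r | Or q r | Imp q r => vars_lt B q && vars_lt B r
  | Ex x q | All x q => (x < B) && vars_lt B q
  end.

Lemma term_vars_lt_leq B B' t : B <= B' -> term_vars_lt B t -> term_vars_lt B' t.
Proof.
move=> BB'; elim/term_nested_ind: t => [i /= iB|f ts]; first exact: leq_trans BB'.
by elim: ts => //= t ts IH [IHt /IH IHts] /andP[/IHt-> /IHts].
Qed.

Lemma vars_lt_leq B B' p : B <= B' -> vars_lt B p -> vars_lt B' p.
Proof.
move=> BB'; have all_leq ts : all (term_vars_lt B) ts -> all (term_vars_lt B') ts.
  by apply: sub_all => t; apply: term_vars_lt_leq.
elim: p => //= [t u|q IHq r IHr|q IHq r IHr|q IHq r IHr|x q IHq|x q IHq].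
- by move=> /andP[/(term_vars_lt_leq BB')-> /(term_vars_lt_leq BB')->].
- by move=> /andP[/IHq-> /IHr->].
- by move=> /andP[/IHq-> /IHr->].
- by move=> /andP[/IHq-> /IHr->].
- by move=> /andP[/leq_trans-> // /IHq->].
- by move=> /andP[/leq_trans-> // /IHq->].
Qed.

Lemma term_vars_bound t : exists B, term_vars_lt B t.
Proof.
elim/term_nested_ind: t => [i|f ts]; first by exists i.+1 => /=.
elim: ts => [|t ts IH] /=; first by exists 0.
move=> [[B HB] /IH[B' HB']]; exists (maxn B B') => /=.
rewrite (term_vars_lt_leq (leq_maxl _ _) HB) /=; move: HB' => /=; apply: sub_all => u.
by apply: term_vars_lt_leq; apply: leq_maxr.
Qed.

Lemma vars_bound p : exists B, vars_lt B p.
Proof.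
have bin q r : (exists B, vars_lt B q) -> (exists B, vars_lt B r) -> exists B, vars_lt B q && vars_lt B r.
  move=> [B HB] [B' HB']; exists (maxn B B').
  by rewrite (vars_lt_leq (leq_maxl _ _) HB) (vars_lt_leq (leq_maxr _ _) HB').
have quant x q : (exists B, vars_lt B q) -> exists B, (x < B) && vars_lt B q.
  move=> [B HB]; exists (maxn x.+1 B).
  by rewrite leq_maxl (vars_lt_leq (leq_maxr _ _) HB).
elim: p => //=; auto.
- by exists 0.
- move=> t u; have [B HB] := term_vars_bound t; have [B' HB'] := term_vars_bound u.
  exists (maxn B B').
  by rewrite (term_vars_lt_leq (leq_maxl _ _) HB) (term_vars_lt_leq (leq_maxr _ _) HB').
- move=> r ts; elim: ts => [|t ts [B' HB']] /=; first by exists 0.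
  have [B HB] := term_vars_bound t; exists (maxn B B').
  rewrite (term_vars_lt_leq (leq_maxl _ _) HB) /=; move: HB'; apply: sub_all => u.
  by apply: term_vars_lt_leq; apply: leq_maxr.
Qed.

Lemma tren_wf f t : term_wf (tren f t) = term_wf t.
Proof.
elim/term_nested_ind: t => //= g ts H; rewrite size_map; congr andb.
by elim: ts H => //= t ts IH [-> /IH->].
Qed.

Lemma ren_wf f p : formula_wf (ren f p) = formula_wf p.
Proof.
elim: p => //= [t u|r ts|q -> r ->|q -> r ->|q -> r ->] //; first by rewrite !tren_wf.
by rewrite size_map all_map; congr andb; apply: eq_all => t /=; apply: tren_wf.
Qed.

Section Sat.
Variable M : structure L.

Lemma eval_ren f B (e e0 : nat -> M) t : term_vars_lt B t ->
  (forall i, i < B -> e (f i) = e0 i) -> eval e (tren f t) = eval e0 t.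
Proof.
move=> + H; elim/term_nested_ind: t => [i /H //|g ts IH /= lt]; congr finterp.
by elim: ts IH lt => //= t ts IHts [IHt /IHts IHs] /andP[/IHt-> /IHs->].
Qed.

Lemma sat_ren f B p (e e0 : nat -> M) : {in gtn B &, injective f} -> vars_lt B p ->
  (forall i, i < B -> e (f i) = e0 i) -> (sat e (ren f p) <-> sat e0 p).
Proof.
move=> injf; elim: p e e0 => //= [t u|r ts|q IH|q IHq r IHr|q IHq r IHr|q IHq r IHr|x q IH|x q IH] e e0.
- by move=> /andP[lt lu] H; rewrite !(eval_ren _ H).
- move=> lt H; have -> // : map (eval e) (map (tren f) ts) = map (eval e0) ts.
  by elim: ts lt => //= t ts IH /andP[lt /IH->]; rewrite (eval_ren lt H).
- by move=> lq H; have := IH e e0 lq H; tauto.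
- by move=> /andP[lq lr] H; have := IHq e e0 lq H; have := IHr e e0 lr H; tauto.
- by move=> /andP[lq lr] H; have := IHq e e0 lq H; have := IHr e e0 lr H; tauto.
- by move=> /andP[lq lr] H; have := IHq e e0 lq H; have := IHr e e0 lr H; tauto.
- move=> /andP[xB lq] H.
  have key m : sat (upd e (f x) m) (ren f q) <-> sat (upd e0 x m) q.
    apply: IH => // i iB; rewrite /upd (inj_in_eq injf) //; case: eqP => // _.
    exact: H.
  by split=> -[m /key]; exists m.
- move=> /andP[xB lq] H.
  have key m : sat (upd e (f x) m) (ren f q) <-> sat (upd e0 x m) q.
    apply: IH => // i iB; rewrite /upd (inj_in_eq injf) //; case: eqP => // _.
    exact: H.
  by split=> K m; apply/key.
Qed.

Lemma sat_ext B p (e e0 : nat -> M) : vars_lt B p -> (forall i, i < B -> e i = e0 i) ->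
  (sat e p <-> sat e0 p).
Proof.
(* Both assignments are compared through [ren id p]. *)
move=> lp H; have inj_id : {in gtn B &, injective (@id nat)} by [].
have H1 := @sat_ren id B p e e inj_id lp (fun _ _ => erefl).
have H2 := @sat_ren id B p e e0 inj_id lp H.
tauto.
Qed.

Definition Exs (vs : seq nat) (p : formula L) : formula L := foldr (@Ex L) p vs.

Lemma Exs_wf vs p : formula_wf (Exs vs p) = formula_wf p.
Proof. by elim: vs. Qed.

Lemma sat_Exs vs p (e : nat -> M) :
  sat e (Exs vs p) <-> exists g : nat -> M, sat (fun i => if i \in vs then g i else e i) p.
Proof.
elim: vs e => [|x vs IH] e /=.
  split; [by exists e|by case].
split.
- move=> [m /IH[g gP]]; exists (fun i => if i \in vs then g i else m).
  move: gP; congr (sat _ p : Prop).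
  apply/funext => i; rewrite inE /upd.
  by case: (i \in vs); rewrite ?orbT ?orbF //; case: eqP.
- move=> [g gP]; exists (g x); apply/IH; exists g.
  move: gP; congr (sat _ p : Prop).
  apply/funext => i; rewrite inE /upd.
  by case: (i \in vs); rewrite ?orbT ?orbF //; case: eqP => [->|].
Qed.

End Sat.
End Syntax.

Lemma ultrafilter_exists : exists U : (nat -> Prop) -> Prop,
  [/\ forall N, U (fun n => N <= n),
      forall A B, U A -> U B -> U (fun n => A n /\ B n),
      forall A B : nat -> Prop, (forall n, A n -> B n) -> U A -> U B,
      forall A, U A -> exists n, A n &
      forall A : nat -> Prop, U A \/ U (fun n => ~ A n)].
Proof.
have [U [UU ev]] := @filter.ultraFilterLemma nat _ filter.eventually_filter.
exists U; split.
- by move=> N; apply: ev; exists N.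
- by move=> A B; apply: filter.filterI.
- by move=> A B AB; apply: filter.filterS.
- by move=> A /filter.filter_ex.
- by move=> A; apply: filter.in_ultra_setVsetC.
Qed.

Section Ultrapower.
Variables (L : signature) (M : structure L) (U : (nat -> Prop) -> Prop).
Hypotheses (UT : forall N, U (fun n => N <= n))
  (UI : forall A B, U A -> U B -> U (fun n => A n /\ B n))
  (US : forall A B : nat -> Prop, (forall n, A n -> B n) -> U A -> U B)
  (Uex : forall A, U A -> exists n, A n)
  (UC : forall A : nat -> Prop, U A \/ U (fun n => ~ A n)).

Lemma U_all (A : nat -> Prop) : (forall n, A n) -> U A.
Proof. by move=> H; apply: US (UT 0). Qed.

Lemma U_not (A : nat -> Prop) : U (fun n => ~ A n) <-> ~ U A.
Proof.
split=> [UnA UA|nUA]; last by case: (UC A).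
by have [n []] := Uex (UI UA UnA).
Qed.

Lemma U_iff (A B C : nat -> Prop) : U A -> (forall n, A n -> (B n <-> C n)) -> (U B <-> U C).
Proof.
move=> UA H; split=> UB; apply: US (UI UA UB) => n [An Bn]; exact/(H n An).
Qed.

Definition ueq (f g : nat -> M) : Prop := U (fun n => f n = g n).

Definition ucl (f : nat -> M) : (nat -> M) -> Prop := fun g => ueq f g.

Lemma uclP f g : ucl f = ucl g <-> ueq f g.
Proof.
split=> [fg|fg]; first by rewrite -/(ucl f g) fg; apply: U_all.
apply/funext => h; apply/propext; apply: U_iff fg _ => n -> //.
Qed.

Definition udom : Type := {c : (nat -> M) -> Prop | exists f, c = ucl f}.

Definition uq (f : nat -> M) : udom := exist _ (ucl f) (ex_intro _ f erefl).

Definition urep (x : udom) : nat -> M := projT1 (cid (projT2 x)).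

Lemma uqK x : uq (urep x) = x.
Proof.
by case: x => c cP; apply: eq_exist; rewrite /urep; case: cid => f /= ->.
Qed.

Lemma urepK f : ueq (urep (uq f)) f.
Proof. by apply/uclP; have := uqK (uq f); case. Qed.

Lemma urep_eq x y : ueq (urep x) (urep y) <-> x = y.
Proof.
split=> [/uclP xy|->]; last by apply: U_all.
by rewrite -(uqK x) -(uqK y); apply: eq_exist.
Qed.

Definition ultrapower : structure L :=
  @Structure L udom (uq (fun=> dom_inh M))
    (fun f xs => uq (fun n => finterp f (map (urep^~ n) xs)))
    (fun r xs => U (fun n => rinterp r (map (urep^~ n) xs))).

Definition slice (e : nat -> ultrapower) (n : nat) : nat -> M := fun v => urep (e v) n.

Lemma los_term (e : nat -> ultrapower) t :
  U (fun n => urep (@eval L ultrapower e t) n = eval (slice e n) t).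
Proof.
elim/term_nested_ind: t => [i|f ts IH] /=; first exact: U_all.
have H : U (fun n => map (urep^~ n) (map (eval e) ts) = map (eval (slice e n)) ts).
  elim: ts IH => [|t ts IHts] /=; first by move=> _; apply: U_all.
  by case=> Ut /IHts Uts; apply: US (UI Ut Uts) => n [-> ->].
apply: US (UI H (urepK (fun n => finterp f (map (urep^~ n) (map (eval e) ts))))).
by move=> n [<- ->].
Qed.

Lemma slice_upd (e : nat -> ultrapower) x (m : ultrapower) n :
  slice (upd e x m) n = upd (slice e n) x (urep m n).
Proof. by apply/funext => v; rewrite /slice /upd; case: eqP. Qed.

Lemma los p (e : nat -> ultrapower) : sat e p <-> U (fun n => sat (slice e n) p).
Proof.
elim: p e => /= [|t u|r ts|q IH|q IHq r IHr|q IHq r IHr|q IHq r IHr|x q IH|x q IH] e.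
- by split=> // /Uex[].
- rewrite -urep_eq; apply: U_iff (UI (los_term e t) (los_term e u)) _.
  by move=> n [-> ->].
- have H : U (fun n => map (urep^~ n) (map (@eval L ultrapower e) ts) = map (eval (slice e n)) ts).
    elim: ts => [|t ts IHts] /=; first by apply: U_all.
    by apply: US (UI (los_term e t) IHts) => n [-> ->].
  by apply: U_iff H _ => n ->.
- by rewrite IH U_not.
- rewrite IHq IHr; split=> [[Uq Ur]|Uqr]; first exact: UI.
  by split; apply: US Uqr => n [].
- rewrite IHq IHr; split=> [[Uq|Ur]|Uqr].
  + by apply: US Uq => n; left.
  + by apply: US Ur => n; right.
  + have [|/(UI Uqr) Unq] := UC (fun n => sat (slice e n) q); first by left.
    by right; apply: US Unq => n [[]].
- rewrite IHq IHr; split=> [Uqr|Uqr Uq].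
  + have [/Uqr|] := UC (fun n => sat (slice e n) q); first by apply: US.
    by apply: US => n nq /nq.
  + by apply: US (UI Uqr Uq) => n [H /H].
- split=> [[m /IH]|Ux].
  + by apply: US => n; rewrite slice_upd => H; exists (urep m n).
  + have /choice[g gP] : forall n, exists g, (exists m, sat (upd (slice e n) x m) q) ->
        sat (upd (slice e n) x g) q.
      move=> n.
      have [[m mP]|no] := EM (exists m, sat (upd (slice e n) x m) q); first by exists m.
      by exists (dom_inh M) => /no.
    exists (uq g); apply/IH; apply: US (UI Ux (urepK g)) => n [/gP + gn].
    by rewrite slice_upd gn.
- split=> [H|Ux m]; last by apply/IH; apply: US Ux => n H; rewrite slice_upd.
  have [//|Un] := UC (fun n => forall m, sat (upd (slice e n) x m) q).
  have /choice[g gP] : forall n, exists g, ~ (forall m, sat (upd (slice e n) x m) q) ->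
      ~ sat (upd (slice e n) x g) q.
    move=> n.
    have [[m mP]|no] := EM (exists m, ~ sat (upd (slice e n) x m) q); first by exists m.
    exists (dom_inh M) => K; case: K => m; apply: contrapT => nm; apply: no; by exists m.
  have /IH Ug := H (uq g).
  have [n [[/gP ng sg] gn]] := Uex (UI (UI Un Ug) (urepK g)).
  by case: ng; move: sg; rewrite slice_upd gn.
Qed.

Lemma ultrapower_model T : model M T -> model ultrapower T.
Proof. by move=> mT s Ts e; apply/los; apply: U_all => n; apply: mT. Qed.

End Ultrapower.

(** * Definability of patterns *)

Definition finite_forks L (M : structure L) (p : formula L) n : Prop :=
  forall N, exists a : seq bool -> nat -> M,
  (forall s, size s = N ->
     exists b, forall m, m <= N -> sat (env b (a (take m s)) n) p) /\
  (forall s s', size s <= N -> size s' <= N -> incomparable s s' ->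
     ~ exists b, sat (env b (a s) n) p /\ sat (env b (a s') n) p).

Definition tree_code (A : eqType) (code : seq A -> seq bool) : Prop :=
  (forall s t, prefix s t -> prefix (code s) (code t)) /\
  (forall s t, incomparable s t -> incomparable (code s) (code t)).

Lemma prefix_mkseq (A : eqType) (eta : nat -> A) m n : m <= n ->
  prefix (mkseq eta m) (mkseq eta n).
Proof.
move=> mn; apply/prefixP; exists (map eta (iota m (n - m))).
by rewrite /mkseq -map_cat -iotaD subnKC.
Qed.

(** In coordinate [i] of the ultrapower, node [s] carries the parameter at [code s] in the finite
    tree of height [i]. Each finite requirement holds in all sufficiently late coordinates. *)
Lemma finite_forks_tree_TP L (T : formula L -> Prop) (A : eqType) code (M : structure L) p n :
  tree_code (A := A) code -> model M T -> formula_wf p -> finite_forks M p n -> tree_TP T A.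
Proof.
move=> [code_pre code_inc] mT wfp /choice[a aP].
have [U [UT UI US Uex UC]] := ultrafilter_exists.
pose N := ultrapower M U.
have [B Bp] := vars_bound p.
pose lift (f : nat -> nat -> M) : nat -> N := fun v => uq U (fun i => f i v).
pose aN (s : seq A) : nat -> N := lift (fun i => a i (code s)).
have rep_lift (x : nat -> N) (f : nat -> nat -> M) :
    (forall v, U (fun i => urep (x v) i = f i v)) ->
    U (fun i => sat (slice x i) p <-> sat (f i) p).
  move=> H; have HB : U (fun i => forall v, v < B -> urep (x v) i = f i v).
    elim: B {Bp} => [|B IH]; first by apply: US (UT 0).
    apply: US (UI _ _ IH (H B)) => i [H1 H2] v; rewrite ltnS leq_eqVlt.
    by case/orP=> [/eqP->//|]; apply: H1.
  by apply: US HB => i Hi; apply: sat_ext Bp _ => v vB; apply: Hi.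
exists p, n, N, aN; split=> //.
- exact: ultrapower_model.
- move=> eta F; pose m0 := \max_(m <- F) m; pose s := code (mkseq eta m0).
  have /choice[b bP] : forall i, exists b, size s <= i -> forall m, m \in F ->
      sat (env b (a i (code (mkseq eta m))) n) p.
    move=> i; have [si|_] := leqP (size s) i; last by exists (fun=> dom_inh M).
    (* Solutions are given for strings of length exactly [i], so the code is padded. *)
    have [|b bP] := (aP i).1 (s ++ nseq (i - size s) false).
      by rewrite size_cat size_nseq subnKC.
    exists b => _ m mF.
    have mm0 : m <= m0 by apply: leq_bigmax_seq.
    have /code_pre pre : prefix (mkseq eta m) (mkseq eta m0) by apply: prefix_mkseq.
    have := bP (size (code (mkseq eta m))).
    rewrite (leq_trans (size_prefix pre) si) => /(_ isT).
    rewrite takel_cat ?(size_prefix pre) //.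
    by move: pre; rewrite prefixE => /eqP->.
  exists (lift b) => m mF; apply/los => //.
  have /(rep_lift _ (fun i => env (b i) (a i (code (mkseq eta m))) n)) Urep v :
      U (fun i => urep (env (lift b) (aN (mkseq eta m)) n v) i =
                  env (b i) (a i (code (mkseq eta m))) n v).
    by rewrite /env; case: ltnP => _; apply: urepK.
  by apply: US (UI _ _ Urep (UT (size s))) => i [H si]; apply/H/bP.
- move=> eta nu /code_inc inc [b [/los H1 /los H2]].
  have rep_env s : U (fun i => sat (slice (env b (aN s) n) i) p <->
                sat (env (fun v => urep (b v) i) (a i (code s)) n) p).
    apply: (rep_lift _ (fun i => env (fun v => urep (b v) i) (a i (code s)) n)) => v.
    rewrite /env; case: ltnP => _; first by apply: US (UT 0).
    exact: urepK.
  have {}H1 := UI _ _ (H1 UT UI US Uex UC) (rep_env eta).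
  have {}H2 := UI _ _ (H2 UT UI US Uex UC) (rep_env nu).
  (* The coordinate is late enough for its tree to contain both codes. *)
  have [i [[[h1 e1] [h2 e2]] ile]] :=
    Uex _ (UI _ _ (UI _ _ H1 H2) (UT (maxn (size (code eta)) (size (code nu))))).
  move: ile; rewrite geq_max => /andP[i1 i2].
  apply: ((aP i).2 _ _ i1 i2 inc); exists (fun v => urep (b v) i).
  by split; [apply/e1|apply/e2].
Qed.

Section Definability.
Variables (L : signature) (M : structure L) (phi : formula L) (n w : nat).
Hypotheses (phi_wf : formula_wf phi) (phi_w : vars_lt w phi) (w_gt0 : 0 < w).

Local Notation P := {classic (nat -> M)}.

Definition holds (b a : P) : Prop := sat (env (b : nat -> M) (a : nat -> M) n) phi.

Definition flat (F : nat -> P) : nat -> M := fun q => (F (q %/ w) : nat -> M) (q %% w).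

Lemma flat_block (F : nat -> P) i c : c < w -> flat F (i * w + c) = (F i : nat -> M) c.
Proof. by move=> cw; rewrite /flat divnMDl // modnMDl modn_small // divn_small ?addn0. Qed.

(** Point [i] occupies the variables from [i * w] to [i * w + w - 1]. The formula sees only the
    first [w] values of a point, so a quantifier over points becomes [w] quantifiers. *)
Lemma definable_formula (Q : (nat -> P) -> Prop) : definable holds Q ->
  exists2 p : formula L, formula_wf p & forall F, sat (flat F) p <-> Q F.
Proof.
elim=> {Q} [|i j ij|Q Q' _ [p wp pP] _ [p' wp' pP']|Q _ [p wp pP]|i Q _ [p wp pP]|Q Q' QQ' _ [p wp pP]].
- by exists (Not (Fal L)) => // F; split=> // _ [].
- pose f v := if v < n then i * w + v else j * w + (v - n).
  exists (ren f phi); first by rewrite ren_wf.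
  move=> F; apply: (sat_ren _ phi_w) => [u v|v vw].
    rewrite !unfold_in /= => uw vw; rewrite /f.
    have uE : forall k x, x < w -> (k * w + x) %/ w = k.
      by move=> k x xw; rewrite divnMDl // divn_small ?addn0.
    have sub_lt x : x < w -> x - n < w by apply: leq_ltn_trans (leq_subr _ _).
    case: (ltnP u n) => un; case: (ltnP v n) => vn.
    + by move/addnI.
    + by move/(congr1 (divn^~ w)); rewrite !uE ?sub_lt // => /eqP; rewrite (negPf ij).
    + by move/(congr1 (divn^~ w)); rewrite !uE ?sub_lt // => /eqP; rewrite eq_sym (negPf ij).
    + by move/addnI => H; rewrite -(subnK un) -(subnK vn) H.
  rewrite /f /env; case: ltnP => vn; rewrite flat_block //.
  exact: leq_ltn_trans (leq_subr _ _) vw.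
- by exists (And p p') => [|F] /=; rewrite ?wp ?wp' // pP pP'.
- by exists (Not p) => // F /=; rewrite pP.
- exists (Exs (iota (i * w) w) p); first by rewrite Exs_wf.
  have blk q : (q \in iota (i * w) w) = (q %/ w == i).
    by rewrite mem_iota eqn_leq -[q %/ w <= i]ltnS ltn_divLR // leq_divRL // andbC mulSn addnC.
  move=> F; rewrite sat_Exs; split.
  + move=> [g gP]; exists (fun c => g (i * w + c)); apply/pP; move: gP.
    congr (sat _ p : Prop); apply/funext => q; rewrite blk /flat /upd.
    by case: eqP => // <-; rewrite -divn_eq.
  + move=> [x /pP xP]; exists (fun q => (x : nat -> M) (q %% w)); move: xP.
    congr (sat _ p : Prop); apply/funext => q; rewrite blk /flat /upd.
    by case: eqP.
- by exists p => // F; rewrite pP.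
Qed.
End Definability.

Section Tame.
Variables (L : signature) (T : formula L -> Prop) (M : structure L) (n : nat).
Variables (A : eqType) (code : seq A -> seq bool).
Hypotheses (HM : model M T) (Hcode : tree_code code) (noTP : ~ tree_TP T A).

Lemma env_flat w k (Y Z : nat -> {classic (nat -> M)}) : 0 < w ->
  env (flat w Y) (flat w Z) (k * w) = flat w (env Y Z k).
Proof.
move=> w0; apply/funext => q; rewrite /env /flat -ltn_divLR //.
case: ltnP => // kq; move: (kq); rewrite leq_divRL // => kwq.
by rewrite -[in RHS](subnKC kwq) divnMDl // modnMDl addKn.
Qed.

(** If no bound [N] exists, the formula defining [Q] has finite SOP_2 trees of every height, hence
    an infinite one. *)
Lemma fork_free_holds (phi : formula L) : formula_wf phi -> fork_free (@holds L M phi n).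
Proof.
move=> wphi k Q dQ; have [B HB] := vars_bound phi; pose w := B.+1.
have w0 : 0 < w by [].
have [p wp pP] := definable_formula wphi (vars_lt_leq (leqnSn B) HB) w0 dQ.
apply: contrapT => H; apply: noTP.
apply: (finite_forks_tree_TP (p := p) (n := k * w) Hcode HM wp) => N.
have [Z [chain inc]] : exists Z : seq bool -> nat -> {classic (nat -> M)},
    (forall s, size s = N -> exists Y, forall m, m <= N -> Q (env Y (Z (take m s)) k)) /\
    ~ (exists s s' Y, [/\ size s <= N, size s' <= N, incomparable s s',
        Q (env Y (Z s) k) & Q (env Y (Z s') k)]).
  apply: contrapT => no; apply: H; exists N => Z chain; apply: contrapT => inc.
  by apply: no; exists Z.
exists (fun s => flat w (Z s)); split.
  move=> s /chain[Y YP]; exists (flat w Y) => m mN.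
  by rewrite env_flat //; apply/pP; apply: YP.
move=> s s' sN s'N ss' [b [b1 b2]]; apply: inc.
pose Y i : {classic (nat -> M)} := fun c => b (i * w + c).
have bY : b = flat w Y by apply/funext => q; rewrite /flat /Y -divn_eq.
by exists s, s', Y; split=> //; apply/pP; rewrite -env_flat // -bY.
Qed.

Lemma sat_conj (I : eqType) (F : I -> formula L) (l : seq I) (e : nat -> M) :
  sat e (foldr (fun i p => And (F i) p) (Not (Fal L)) l) <-> forall i, i \in l -> sat e (F i).
Proof.
elim: l => [|i l IH] /=; first by split=> // _ [].
rewrite IH; split=> [[Fi Fl] j|H]; first by rewrite inE => /orP[/eqP->|/Fl].
by split=> [|j jl]; apply: H; rewrite inE ?eqxx // jl orbT.
Qed.

(** The parameter tuples are interleaved: coordinate [c] comes from parameter number [c %% d]. A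
    list shorter than [d] is padded with its first entry, so it must be nonempty. *)
Lemma conjunction_formula (phi : formula L) d : formula_wf phi ->
  exists2 phi' : formula L, formula_wf phi' &
  forall (Y : eqType) (a : Y -> nat -> M) (D : seq Y), 0 < size D <= d ->
  exists p, forall b, sat (env b p n) phi' <-> forall y, y \in D -> sat (env b (a y) n) phi.
Proof.
move=> wphi; pose f j v := if v < n then v else n + ((v - n) * d + j).
exists (foldr (fun j p => And (ren (f j) phi) p) (Not (Fal L)) (iota 0 d)).
  by elim: (iota 0 d) => //= j l ->; rewrite ren_wf wphi.
have [B HB] := vars_bound phi.
move=> Y a [//|y0 D] /andP[_ sD]; have d0 : 0 < d by apply: leq_trans sD.
pose s := y0 :: D.
exists (fun c => a (nth y0 s (c %% d)) (c %/ d)) => b; rewrite sat_conj.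
have key j : j < d -> (sat (env b (fun c => a (nth y0 s (c %% d)) (c %/ d)) n) (ren (f j) phi) <->
    sat (env b (a (nth y0 s j)) n) phi).
  move=> jd; apply: (sat_ren _ HB) => [u v _ _|v _]; rewrite /f.
    case: (ltnP u n) => un; case: (ltnP v n) => vn //.
    + by move=> uE; move: un; rewrite uE ltnNge leq_addr.
    + by move=> vE; move: vn; rewrite -vE ltnNge leq_addr.
    + by move=> /addnI/addIn/eqP; rewrite eqn_pmul2r // => /eqP H; rewrite -(subnK un) -(subnK vn) H.
  rewrite /env; case: (ltnP v n) => vn; first by rewrite vn.
  by rewrite ltnNge leq_addr /= addKn modnMDl divnMDl // modn_small // divn_small // addn0.
split=> [H y yD|H j].
  rewrite -(nth_index y0 yD); have iy : index y s < size s by rewrite index_mem.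
  by apply/key; [apply: leq_trans sD|apply: H; rewrite mem_iota /=; apply: leq_trans sD].
rewrite mem_iota /= add0n => jd; apply/key => //; apply: H.
have [js|js] := ltnP j (size s); first exact: mem_nth.
by rewrite nth_default // mem_head.
Qed.

Lemma tame_params (phi : formula L) (Y : eqType) (a : Y -> nat -> M) : formula_wf phi ->
  tame (fun (b : {classic (nat -> M)}) y => sat (env (b : nat -> M) (a y) n) phi).
Proof.
move=> wphi d; have [phi' wphi' phiP] := conjunction_formula d wphi.
have /choice[th thP] : forall D : seq Y, exists p : {classic (nat -> M)}, 0 < size D <= d ->
    forall b : nat -> M, sat (env b (p : nat -> M) n) phi' <->
      forall y, y \in D -> sat (env b (a y) n) phi.
  move=> D; have [Dd|_] := boolP (0 < size D <= d); last by exists (fun=> dom_inh M).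
  by have [p pP] := phiP Y a D Dd; exists p.
exists (@holds L M phi' n), th; split; first exact: fork_free_holds.
by move=> D Dd x; apply: thP.
Qed.

End Tame.


(** * Strong similarity *)

Section Sequences.
Variables (A : eqType) (ltA : rel A).
Implicit Types (s t w x y : seq A) (c : A).

Lemma prefix_rconsP s t c : prefix (rcons s c) t -> exists u, t = s ++ c :: u.
Proof. by case/prefixP=> u ->; exists u; rewrite cat_rcons. Qed.

Lemma cmp_lt x y c : prefix (rcons x c) y ->
  [/\ (x == y) = false, prefix x y, lexlt ltA x y & meet x y = x].
Proof.
case/prefix_rconsP=> u ->; split.
- apply/negP => /eqP/(congr1 size)/eqP; rewrite size_cat -{1}[size x]addn0.
  by rewrite eqn_add2l.
- exact: prefix_prefix.
- by elim: x => //= z x IH; rewrite eqxx.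
- by elim: x => //= z x IH; rewrite eqxx IH.
Qed.

Lemma cmp_gt x y c : prefix (rcons x c) y ->
  [/\ (y == x) = false, prefix y x = false, lexlt ltA y x = false & meet y x = x].
Proof.
move=> xy; have [nxy _ _ _] := cmp_lt xy; case/prefix_rconsP: xy nxy => u -> nxy; split.
- by rewrite eq_sym.
- apply/negP => /size_prefix; rewrite size_cat /= addnS ltnNge leq_addr //.
- by elim: x {nxy} => //= z x IH; rewrite eqxx.
- by elim: x {nxy} => //= z x IH; rewrite eqxx IH.
Qed.

Lemma cmp_div w x y c c' : c != c' -> prefix (rcons w c) x -> prefix (rcons w c') y ->
  [/\ (x == y) = false, prefix x y = false, lexlt ltA x y = ltA c c' & meet x y = w].
Proof.
move=> cc' /prefix_rconsP[u ->] /prefix_rconsP[v ->]; elim: w => [|z w [IH1 IH2 IH3 IH4]] /=.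
  by rewrite eqseq_cons (negPf cc').
by rewrite eqseq_cons !eqxx IH1 IH2 IH3 IH4.
Qed.

Lemma cmp_cases x y : [\/ x = y, exists c, prefix (rcons x c) y,
  exists c, prefix (rcons y c) x |
  exists w c c', [/\ c != c', prefix (rcons w c) x & prefix (rcons w c') y]].
Proof.
elim: x y => [|a x IH] [|b y]; first exact: Or41.
- by apply: Or42; exists b; rewrite /= eqxx prefix0s.
- by apply: Or43; exists a; rewrite /= eqxx prefix0s.
have [<-|ab] := eqVneq a b; last first.
  by apply: Or44; exists [::], a, b; rewrite /= !eqxx !prefix0s.
case: (IH y) => [->|[c H]|[c H]|[w [c [c' [cc' H1 H2]]]]].
- exact: Or41.
- by apply: Or42; exists c; rewrite /= eqxx.
- by apply: Or43; exists c; rewrite /= eqxx.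
- by apply: Or44; exists (a :: w), c, c'; rewrite /= eqxx.
Qed.

Section Similarity.
Variables (nubar : seq (seq A)) (g : seq A -> seq A).
Definition below x : bool := has (prefix x) nubar.

Hypothesis gP : forall x y c, below y -> prefix (rcons x c) y ->
  prefix (rcons (g x) c) (g y).

Lemma below_prefix x y : prefix x y -> below y -> below x.
Proof. by move=> xy /hasP[z zn yz]; apply/hasP; exists z => //; apply: prefix_trans yz. Qed.

(** The position of two sequences is decided by where they part and with which letters, that is, by
    facts of the form in [gP]; the four cases of [cmp_cases] correspond under [g]. *)
Lemma similar_pair x y : below x -> below y ->
  [/\ (g x == g y) = (x == y), prefix (g x) (g y) = prefix x y,
      lexlt ltA (g x) (g y) = lexlt ltA x y & meet (g x) (g y) = g (meet x y)].
Proof.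
have lexx z : lexlt ltA z z = false by elim: z => //= a z IH; rewrite eqxx.
have meetxx z : meet z z = z by elim: z => //= a z IH; rewrite eqxx IH.
move=> bx by_; case: (cmp_cases x y) => [<-|[c H]|[c H]|[w [c [c' [cc' H1 H2]]]]].
- by rewrite !eqxx !prefix_refl !lexx !meetxx.
- have [-> -> -> ->] := cmp_lt H.
  by have [-> -> -> ->] := cmp_lt (gP by_ H).
- have [-> -> -> ->] := cmp_gt H.
  by have [-> -> -> ->] := cmp_gt (gP bx H).
- have [-> -> -> ->] := cmp_div cc' H1 H2.
  by have [-> -> -> ->] := cmp_div cc' (gP bx H1) (gP by_ H2).
Qed.

Lemma meet_prefix x y : prefix (meet x y) x.
Proof. by elim: x y => //= a x IH [|b y] //=; case: eqP => //= _; rewrite eqxx IH. Qed.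

Lemma meval_map u : mterm_vars_lt (size nubar) u ->
  below (meval nubar u) /\ meval (map g nubar) u = g (meval nubar u).
Proof.
elim: u => [i|u IHu v IHv] /= lt.
  rewrite (nth_map [::]) //; split=> //; apply/hasP; exists (nth [::] nubar i).
    exact: mem_nth.
  exact: prefix_refl.
move/andP: lt => [/IHu[bu ->] /IHv[bv ->]]; split.
  exact: below_prefix (meet_prefix _ _) bu.
by have [] := similar_pair bu bv.
Qed.

Lemma map_strongly_similar : strongly_similar ltA (map g nubar) nubar.
Proof.
split; first by rewrite size_map.
move=> u v; rewrite size_map => /meval_map[bu ->] /meval_map[bv ->].
by have [] := similar_pair bu bv.
Qed.

End Similarity.
End Sequences.

(** * From shapes back to tuples of sequences *)

Section BaseTree.
Variables (A : eqType) (K : nat) (letter : 'I_K -> A).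
Hypotheses (K_gt1 : 1 < K) (letter_inj : injective letter).
Local Notation tree := (tree K).

Fixpoint base N (rho : seq A) : tree (seq A) :=
  if N is N'.+1 then Un rho (Br (fun i => base N' (rcons rho (letter i)))) else Emp.

Lemma full_base N rho : full N (base N rho).
Proof. by elim: N rho => // N IH rho; apply: fullSP => i; apply: IH. Qed.

Lemma narrow1_Br X (f : 'I_K -> tree X) : narrow 1 (Br f) ->
  (exists i, forall k, k != i -> f k = Emp).
Proof.
move=> [c1 _]; have i0 : 'I_K := Ordinal (ltnW K_gt1).
have fE k : k \notin [set i | ~~ isE (f i)] -> f k = Emp by rewrite inE negbK; case: (f k).
case: (set_0Vmem [set i | ~~ isE (f i)]) => [s0|[i si]].
  by exists i0 => k _; apply: fE; rewrite s0 inE.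
exists i => k ki; apply: fE; apply: contraNN ki => sk.
by move/card_le1_eqP: c1 => /(_ _ _ sk si) ->.
Qed.

Lemma chain_branch N rho z : emb z (base N rho) -> narrow 1 z ->
  exists2 la, prefix rho la & forall y, y \in lab z -> prefix y la.
Proof.
elim: N rho z => [|N IH] rho z /= e nz.
  by exists rho; [exact: prefix_refl|inversion e; subst].
have brP s : emb s (Br (fun i => base N (rcons rho (letter i)))) -> narrow 1 s ->
    exists2 la, prefix rho la & forall y, y \in lab s -> prefix y la.
  have inP i s' : emb s' (base N (rcons rho (letter i))) -> narrow 1 s' ->
      exists2 la, prefix rho la & forall y, y \in lab s' -> prefix y la.
    move=> /IH H /H[la pla laP]; exists la => //.
    exact: prefix_trans (prefix_rcons _ _) pla.
  move=> es ns; inversion es; subst.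
  + by exists rho; first exact: prefix_refl.
  + have [i iP] := narrow1_Br ns.
    have [la pla laP] := inP i (f i) (H1 i) (ns.2 i); exists la => // y /lab_BrP[k yk].
    apply: laP; have [<-//|ki] := eqVneq k i.
    by move: yk; rewrite iP.
  + exact: inP H1 ns.
inversion e; subst.
- by exists rho; first exact: prefix_refl.
- have [la pla laP] := brP _ H1 nz; exists la => // y; rewrite inE => /orP[/eqP->//|].
  exact: laP.
- exact: brP H1 nz.
Qed.

Lemma emb_Un_base N rho v u : emb (Un v u) (base N rho) -> exists N', prefix rho v /\
  emb u (Br (fun i => base N' (rcons v (letter i)))).
Proof.
elim: N rho => [|N IH] rho /= e; inversion e; subst.
  by exists N; rewrite prefix_refl.
inversion H1; subst; have [N' [pv eu]] := IH _ H2; exists N'; split=> //.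
exact: prefix_trans (prefix_rcons _ _) pv.
Qed.

Lemma emb_Br_base N rho f : emb (Br f) (Br (fun i => base N (rcons rho (letter i)))) ->
  exists N' m, prefix rho m /\ forall i, emb (f i) (base N' (rcons m (letter i))).
Proof.
elim: N rho => [|N IH] rho /= e; inversion e; subst.
- by exists 0, rho; rewrite prefix_refl.
- by inversion H1.
- by exists N.+1, rho; rewrite prefix_refl.
- inversion H1; subst; have [N' [m [pm fm]]] := IH _ H2; exists N', m; split=> //.
  exact: prefix_trans (prefix_rcons _ _) pm.
Qed.

Definition letters (s : seq A) : Prop := forall c, c \in s -> exists i, c = letter i.

(* [h] lists the labels of the copy and [m] its branching points. *)
Lemma copy_maps H N rho s : emb s (base N rho) -> full H s ->
  exists h m : seq A -> seq A, forall x, letters x -> size x < H ->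
  [/\ h x \in lab s, prefix rho (h x), prefix (h x) (m x) &
      forall i, (size x).+1 < H -> prefix (rcons (m x) (letter i)) (h (rcons x (letter i)))].
Proof.
elim: H N rho s => [|H IH] N rho s es.
  by move=> _; exists id, id.
move=> /full_S[v [f [sE ff]]]; subst s.
have [N' [pv /emb_Br_base[N2 [m0 [pm fm]]]]] := emb_Un_base es.
have /fin_all_exists[hm hmP] : forall i, exists hm : (seq A -> seq A) * (seq A -> seq A),
  forall x, letters x -> size x < H ->
  [/\ hm.1 x \in lab (f i), prefix (rcons m0 (letter i)) (hm.1 x), prefix (hm.1 x) (hm.2 x) &
      forall j, (size x).+1 < H -> prefix (rcons (hm.2 x) (letter j)) (hm.1 (rcons x (letter j)))].
  by move=> i; have [h [m hmP]] := IH _ _ _ (fm i) (ff i); exists (h, m).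
pose sel c := [pick i | letter i == c].
have selP i : sel (letter i) = Some i.
  by rewrite /sel; case: pickP => [j /eqP/letter_inj->//|/(_ i)]; rewrite eqxx.
exists (fun x => if x is c :: x' then if sel c is Some i then (hm i).1 x' else [::] else v).
exists (fun x => if x is c :: x' then if sel c is Some i then (hm i).2 x' else [::] else m0).
move=> [_ _|c x' lx].
  split=> //=; first by rewrite inE eqxx.
  by move=> i H1; rewrite selP; case: (hmP i [::]).
rewrite /= ltnS => sx; have [i ci] := lx c (mem_head _ _); subst c.
have lx' : letters x' by move=> c cx; apply: lx; rewrite inE cx orbT.
rewrite selP; have [h1 h2 h3 h4] := hmP i x' lx' sx; split=> //.
- by rewrite inE; apply/orP; right; apply/lab_BrP; exists i.
- apply: prefix_trans pv _; apply: prefix_trans pm _.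
  exact: prefix_trans (prefix_rcons _ _) h2.
Qed.

Lemma letters_prefix x y : prefix x y -> letters y -> letters x.
Proof. by case/prefixP=> u -> ly c cx; apply: ly; rewrite mem_cat cx. Qed.

(** Strong similarity allows splitting points to move, so a consistent copy of a full tree of height
    [H], above the length of every entry, contains a tuple similar to [nubar]. *)
Lemma consistent_copy (ltA : rel A) (P : eqType) (r : P -> seq A -> Prop) nubar :
  tame r -> (forall la, Con r [seq take m la | m <- iota 0 (size la).+1]) ->
  antichain nubar -> (forall nu, nu \in nubar -> letters nu) ->
  exists2 mubar, strongly_similar ltA mubar nubar & Con r mubar.
Proof.
move=> tr_r branch anti ln.
pose H := (\max_(nu <- nubar) size nu).+1.
have nuH nu : nu \in nubar -> size nu < H by move=> nn; rewrite ltnS; apply: leq_bigmax_seq.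
have [N HN] := every_shape_consistent K_gt1 tr_r (fullS K H).
have gd : chains_consistent r (base N [::]).
  move=> z ez /(chain_branch ez)[la _ laP]; apply: Con_sub (branch la) => y /laP yla.
  apply/mapP; exists (size y); last by apply/esym/eqP; rewrite -prefixE.
  by rewrite mem_iota /= add0n ltnS size_prefix.
have [s [es fs cs]] := HN _ (full_base N [::]) gd.
have [h [m hmP]] := copy_maps es fs.
(* A proper meet of an antichain goes to the branching point [m x] above [h x]. *)
pose g x := if x \in nubar then h x else m x.
have belowP y : below nubar y -> letters y /\ size y < H.
  case/hasP=> nu nn ynu; split; first exact: letters_prefix ynu (ln _ nn).
  exact: leq_ltn_trans (size_prefix ynu) (nuH _ nn).
(* The path alternates between branching points and labels above them, and so stays in the cone
   chosen at [m x]. *)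
have step x c u : letters (x ++ c :: u) -> size (x ++ c :: u) < H ->
    prefix (rcons (m x) c) (h (x ++ c :: u)).
  have letter_last v d : letters (rcons v d) -> exists i, d = letter i.
    by apply; rewrite mem_rcons mem_head.
  elim/last_ind: u => [|u c' IH].
    rewrite cats1 size_rcons => lx sx; have [i ->] := letter_last _ _ lx.
    have [_ _ _] := hmP x (letters_prefix (prefix_rcons _ _) lx) (ltnW sx).
    by apply.
  rewrite -rcons_cons -rcons_cat size_rcons => lx sx.
  have [i ->] := letter_last _ _ lx.
  have lx' := letters_prefix (prefix_rcons _ _) lx.
  have [_ _ hm_ /(_ i sx) mh] := hmP _ lx' (ltnW sx).
  apply: prefix_trans (IH lx' (ltnW sx)) _; apply: prefix_trans hm_ _.
  exact: prefix_trans (prefix_rcons _ _) mh.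
exists (map g nubar).
  apply: map_strongly_similar => x y c by_ xy.
  have [u yE] := prefix_rconsP xy; have [ly sy] := belowP y by_.
  (* A proper initial segment of an entry is not an entry, by the antichain condition; hence [g x]
     is [m x]. *)
  have xn : x \notin nubar.
    apply/negP => xn; case/hasP: by_ => nu nn ynu.
    have xnu : prefix x nu.
      by apply: prefix_trans ynu; rewrite yE; apply: prefix_prefix.
    have neq : x != nu.
      apply/negP => /eqP xE; have := size_prefix ynu.
      by rewrite -xE yE size_cat /= addnS ltnNge leq_addr.
    move/(pairwiseP [::]): anti => pw.
    have := neq; rewrite -(nth_index [::] xn) -(nth_index [::] nn).
    have xi : index x nubar \in gtn (size nubar) by rewrite inE index_mem.
    have ni : index nu nubar \in gtn (size nubar) by rewrite inE index_mem.
    case: (ltngtP (index x nubar) (index nu nubar)) => [lt|gt|->]; last by rewrite eqxx.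
    + by have := pw _ _ xi ni lt; rewrite /incomparable !nth_index // xnu.
    + by have := pw _ _ ni xi gt; rewrite /incomparable !nth_index // xnu andbF.
  rewrite {1}/g (negPf xn); apply: (@prefix_trans _ (h y)).
    by rewrite yE; apply: step; rewrite -yE.
  rewrite /g; case: ifP => _; first exact: prefix_refl.
  by have [] := hmP y ly sy.
apply: Con_sub cs => _ /mapP[nu nn ->]; rewrite /g nn.
by have [] := hmP nu (ln _ nn) (nuH _ nn).
Qed.

End BaseTree.

(** * The two implications *)

Lemma tree_TP_strTP L (T : formula L -> Prop) (A : eqType) (ltA : rel A) nubar :
  1 < size nubar -> antichain nubar -> tree_TP T A -> tree_strTP T ltA nubar.
Proof.
move=> k1 anti [phi [n [M [a [wf mT bc inc]]]]]; exists phi, n, M, a; split=> //.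
move=> mubar [sz sim] [b bP].
have k0 := ltnW k1.
have in01 : incomparable (nth [::] nubar 0) (nth [::] nubar 1).
  by move/(pairwiseP [::]): anti; apply; rewrite ?inE.
have l0 : mterm_vars_lt (size mubar) (MV 0) by rewrite sz.
have l1 : mterm_vars_lt (size mubar) (MV 1) by rewrite sz.
have [_ /= p01 _] := sim _ _ l0 l1; have [_ /= p10 _] := sim _ _ l1 l0.
apply: (inc (nth [::] mubar 0) (nth [::] mubar 1)).
  by move: in01; rewrite /incomparable p01 p10.
by exists b; split; apply: bP; apply: mem_nth; rewrite sz.
Qed.

Lemma strTP_tree_TP L (T : formula L -> Prop) (A : eqType) (ltA : rel A) nubar
    (code : seq A -> seq bool) K (letter : 'I_K -> A) :
  tree_code code -> 1 < K -> injective letter -> antichain nubar ->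
  (forall nu, nu \in nubar -> letters letter nu) ->
  tree_strTP T ltA nubar -> tree_TP T A.
Proof.
move=> cd K1 inj_i anti ln [phi [n [M [a [wf mT bc inc]]]]].
apply: contrapT => noTP.
have tm := tame_params n mT cd noTP a wf.
have [|mubar sim [b bP]] := consistent_copy K1 inj_i ltA tm _ anti ln; last first.
  by apply: (inc mubar sim); exists b.
(* The default letter prolongs [la] to an infinite branch. *)
move=> la; pose c0 := letter (Ordinal (ltnW K1)).
have [b bP] := bc (nth c0 la) (iota 0 (size la).+1); exists b => y /mapP[m mi ->].
have -> : take m la = mkseq (nth c0 la) m; last exact: bP.
move: mi; rewrite mem_iota /= add0n ltnS => mla.
apply: (@eq_from_nth _ c0); first by rewrite size_mkseq size_takel.
by rewrite size_takel // => i im; rewrite nth_take // nth_mkseq.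
Qed.

(** The words for single letters form a prefix-free code, so incomparability is preserved. *)
Definition unary (s : seq nat) : seq bool := flatten [seq rcons (nseq j true) false | j <- s].

Lemma incomparable_cat (A : eqType) (u s t : seq A) :
  incomparable (u ++ s) (u ++ t) = incomparable s t.
Proof. by elim: u => //= x u IH; rewrite /incomparable /= !eqxx. Qed.

Lemma tree_code_unary : tree_code unary.
Proof.
have sep x y s t : x < y -> incomparable (rcons (nseq x true) false ++ s)
    (rcons (nseq y true) false ++ t).
  move=> xy; rewrite -(subnKC xy) addSnnS nseqD -!cats1 -!catA incomparable_cat.
  by [].
split=> [s t /prefixP[u ->]|].
  by rewrite /unary map_cat flatten_cat; apply: prefix_prefix.
elim=> [|x s IH] [|y t] //; rewrite ?/incomparable ?prefix0s ?andbF // -!/(incomparable _ _).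
have [<-|xy] := eqVneq x y.
  by rewrite -cat1s -[x :: t]cat1s incomparable_cat => /IH; rewrite /unary /= incomparable_cat.
move=> _; rewrite /unary /=.
move: xy; rewrite neq_ltn => /orP[] xy; first exact: sep.
by rewrite /incomparable andbC; apply: sep.
Qed.

Theorem theorem2p11 (L : signature) (T : formula L -> Prop)
    (HT : complete_theory T) (k : nat) (hk : 1 < k) :
  (forall nubar : seq (seq nat), size nubar = k -> antichain nubar ->
     (TP1 T <-> str_TP1 T nubar)) /\
  (forall nubar : seq (seq bool), size nubar = k -> antichain nubar ->
     (SOP2 T <-> str_SOP2 T nubar)).
Proof.
split=> nubar nk anti; split.
- by apply: tree_TP_strTP; rewrite ?nk.
(* Finitely many letters occur in [nubar]; one successor exceeds them all, and the second ensures
   [1 < K]. *)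
- pose K := (\max_(c <- flatten nubar) c).+2.
  apply: (@strTP_tree_TP _ _ _ _ _ unary K (@nat_of_ord K)) => //.
  + exact: tree_code_unary.
  + exact: ord_inj.
  + move=> nu nn c cn.
    have cK : c < K.
      by apply: leqW; apply: leq_bigmax_seq => //; apply/flattenP; exists nu.
    by exists (Ordinal cK).
- by apply: tree_TP_strTP; rewrite ?nk.
- apply: (@strTP_tree_TP _ _ _ _ _ id 2 (fun i => i == ord_max)) => //.
  + by move=> [[|[|i]] ?] [[|[|j]] ?] // _; apply: val_inj.
  + by move=> nu nn [] _; [exists ord_max|exists ord0].
Qed.
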